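(* Let $X=(X_n:n\ge 0)$ be an $S$-valued Markov chain with one-step transition kernel $P$ having a unique stationary distribution $\pi$, and let $f:S\to\mathbb{R}_+$ be a non-negative measurable function. Suppose there exist a non-empty (measurable) subset $C\subset S$, non-negative measurable functions $v_1,v_2:S\to\mathbb{R}_+$, a probability measure $\varphi$ on $S$, an integer $m\ge 1$, and positive constants $\lambda,b_1,b_2$ such that (i) $(Pv_1)(x)\le v_1(x)-f(x)+b_1\mathbb{I}_C(x)$ for all $x\in S$; (ii) $(Pv_2)(x)\le v_2(x)-1+b_2\mathbb{I}_C(x)$ for all $x\in S$; (iii) $\mathbb{P}_x(X_m\in\cdot)\ge\lambda\varphi(\cdot)$ for all $x\in C$. Let $\tau$ be the randomized stopping time constructed from $C,m,\lambda,\varphi$ as described in the context, let $f_c=f-\pi f$, and let $$g^*(x)=\mathbb{E}_x\sum_{j=0}^{\tau-1}f_c(X_j),\qquad x\in S.$$ Then $g^*$ is a solution of Poisson's equation for the forcing function $f_c$; that is, $\int_S|g^*(y)|\,P(x,dy)<\infty$ for every $x\in S$ and $$(P-I)g^*=-f_c .$$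
   Context: Notation. $(Ph)(x)=\int_S h(y)P(x,dy)$; $\mu h=\int_S h\,d\mu$; $I$ is the identity operator; $\mathbb{I}_C$ is the indicator function of $C$; $\mathbb{P}_x(\cdot)=\mathbb{P}(\cdot\mid X_0=x)$ with expectation $\mathbb{E}_x$; $\mathbb{P}_\mu=\int_S\mu(dx)\mathbb{P}_x$ with expectation $\mathbb{E}_\mu$. Under hypotheses (i)-(iii), $\pi f\le b_1<\infty$, so $f_c$ is well defined, and the expectation defining $g^*$ is finite. Construction of $\tau$. By (iii), for $x\in C$ one can write $\mathbb{P}_x(X_m\in\cdot)=\lambda\varphi(\cdot)+(1-\lambda)Q(x,\cdot)$, which defines the probability $Q(x,\cdot)$ (arbitrary if $\lambda=1$). Let $R(x,y,\cdot)=\mathbb{P}_x((X_1,\dots,X_{m-1})\in\cdot\mid X_m=y)$ be the (regular) conditional distribution of the intermediate states given the endpoint; it is assumed to exist, as is the case for instance if $S$ is a standard Borel space, and it is not needed if $m=1$. Let $T_1=\inf\{n\ge 0:X_n\in C\}$ and $T_{i+1}=\inf\{n\ge T_i+m:X_n\in C\}$ for $i\ge 1$. The path of $X$ is generated as follows. From the initial state, run $X$ with kernel $P$ until time $T_1$. At each time $T_i$, generate a Bernoulli($\lambda$) random variable $B_{T_i}$ independently of everything generated so far; draw $X_{T_i+m}$ from $\varphi$ if $B_{T_i}=1$ and from $Q(X_{T_i},\cdot)$ if $B_{T_i}=0$; draw $(X_{T_i+1},\dots,X_{T_i+m-1})$ from $R(X_{T_i},X_{T_i+m},\cdot)$; then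 run $X$ with kernel $P$ from time $T_i+m$ until time $T_{i+1}$. This preserves the law of the Markov chain $X$ with kernel $P$. Put $\beta=\inf\{n\ge 1:B_{T_n}=1\}$ and $\tau=T_\beta+m$. The same construction is used for every initial distribution of $X_0$, and $\mathbb{P}_x,\mathbb{E}_x,\mathbb{P}_\mu,\mathbb{E}_\mu$ refer to this enlarged probability space. *)

(* Defs.v *)
From mathcomp Require Import all_boot all_order all_algebra.
From mathcomp Require Import all_classical all_reals all_analysis.

Set Implicit Arguments.
Unset Strict Implicit.
Unset Printing Implicit Defensive.

Local Open Scope classical_set_scope.
Local Open Scope ring_scope.
Local Open Scope ereal_scope.

Section markov_chains.
Context {R : realType} {d dO : measure_display}.
Context {S : measurableType d} {Omega : measurableType dO}.

(* On the event D, the conditional distribution of Y given H is k.  It is only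
   used for events D that belong to the sigma-algebra generated by H, and for
   kernels k that are functions of H. *)
Definition cond_law {d1 d2} {T1 : measurableType d1} {T2 : measurableType d2}
    (mu : {measure set Omega -> \bar R}) (D : set Omega) (H : Omega -> T1)
    (Y : Omega -> T2) (k : Omega -> set T2 -> \bar R) : Prop :=
  forall (A : set T1) (B : set T2), measurable A -> measurable B ->
    mu (D `&` H @^-1` A `&` Y @^-1` B) =
    \int[mu]_(w in D `&` H @^-1` A) k w B.

Definition stationary (P : R.-pker S ~> S) (mu : probability S R) : Prop :=
  forall A, measurable A -> \int[mu]_x P x A = mu A.

(* Probabilities are set functions on all subsets, hence unique only up to
   their values on the measurable ones. *)
Definition unique_stationary (P : R.-pker S ~> S) (pi : probability S R) :
    Prop :=
  stationary P pi /\
  forall mu : probability S R, stationary P mu ->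
    forall A, measurable A -> mu A = pi A.

(* (X_0, ..., X_n) *)
Definition past (X : nat -> Omega -> S) n (w : Omega) : n.+1.-tuple S :=
  [tuple X i w | i < n.+1].

(* X is, for every x, a Markov chain with kernel P started at x under Pr x.
   Kernel measurability of Pr is what makes the mixtures P_mu meaningful. *)
Definition markov_chain (P : R.-pker S ~> S) (Pr : R.-pker S ~> Omega)
    (X : nat -> {mfun Omega >-> S}) : Prop :=
  forall x,
    (forall A, measurable A -> Pr x (X 0%N @^-1` A) = \d_x A) /\
    (forall n, cond_law (Pr x) setT (past X n) (X n.+1)
                        (fun w => P (X n w))).

Definition poisson_solution (P : R.-pker S ~> S) (h g : S -> \bar R) : Prop :=
  forall x, (P x).-integrable [set: S] g /\ \int[P x]_y g y - g x = - h x.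

End markov_chains.

(* inf A, with None standing for the infimum of the empty set, +oo *)
Definition first (A : set nat) : option nat :=
  if pselect (exists n, n \in A) is left exA then Some (ex_minn exA) else None.

(* Random times as functionals of a trajectory xs and of coins bs; the coin
   bs n is only meaningful when n is one of the times T_1, T_2, ... *)
Section randomized_time.
Context {S : Type} (C : set S) (m : nat).
Implicit Types (xs : nat -> S) (bs : nat -> bool).

(* attempt xs i is the time T_{i+1} *)
Fixpoint attempt xs (i : nat) : option nat :=
  if i is j.+1 then
    obind (fun t => first [set n | (t + m <= n)%N /\ C (xs n)]) (attempt xs j)
  else first [set n | C (xs n)].

Definition is_attempt xs (n : nat) : Prop := exists i, attempt xs i = Some n.

(* n is neither some T_i nor strictly between some T_i and T_i + m *)
Definition is_free xs (n : nat) : Prop :=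
  forall i t, attempt xs i = Some t -> ~ (t <= n < t + m)%N.

(* the index i of the first success is beta - 1 *)
Definition first_success xs bs : option nat :=
  first [set i | exists2 t, attempt xs i = Some t & bs t].

Definition tau xs bs : option nat :=
  obind (fun i => omap (addn^~ m) (attempt xs i)) (first_success xs bs).

End randomized_time.

Section split_chain.
Context {R : realType} {d dO : measure_display}.
Context {S : measurableType d} {Omega : measurableType dO}.
Context (P : R.-pker S ~> S) (Pr : R.-pker S ~> Omega).
Context (X : nat -> {mfun Omega >-> S}) (B : nat -> {mfun Omega >-> bool}).
Context (C : set S) (m : nat) (lambda : R) (phi : probability S R).

Definition attempt_at (n : nat) : set Omega :=
  [set w | is_attempt C m (X ^~ w) n].

Definition free_at (n : nat) : set Omega :=
  [set w | is_free C m (X ^~ w) n].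

(* All that has been generated when the construction reaches time n, if n is
   free or an attempt time: X_0, ..., X_n and the coins of the earlier
   attempts.  Values of B off the attempt times are masked. *)
Definition history n (w : Omega) : n.+1.-tuple S * n.-tuple bool :=
  (past X n w, [tuple `[< attempt_at i w >] && B i w | i < n]).

(* (X_{n+1}, ..., X_{n+m-1}) *)
Definition intermediate n (w : Omega) : m.-1.-tuple S :=
  [tuple X (n + i.+1)%N w | i < m.-1].

(* Q is arbitrary outside C, and everywhere if lambda = 1. *)
Definition residual_kernel (Q : R.-pker S ~> S) : Prop :=
  forall x, C x -> forall A, measurable A ->
    Pr x (X m @^-1` A) = lambda%:E * phi A + (1 - lambda)%:E * Q x A.

(* K (x, y) is the law of (X_1, ..., X_{m-1}) under P_x given X_m = y *)
Definition bridge_kernel (K : R.-pker (S * S)%type ~> (m.-1.-tuple S)) :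
    Prop :=
  forall x, C x ->
    cond_law (Pr x) setT (X m) (intermediate 0) (fun w => K (x, X m w)).

Definition split_construction (Q : R.-pker S ~> S)
    (K : R.-pker (S * S)%type ~> (m.-1.-tuple S)) : Prop :=
  forall x n,
  [/\ cond_law (Pr x) (free_at n) (history n) (X n.+1)
        (fun w => P (X n w)),
      cond_law (Pr x) (attempt_at n) (history n) (B n)
        (fun _ => bernoulli_prob lambda),
      cond_law (Pr x) (attempt_at n)
        (fun w => (history n w, B n w)) (X (n + m)%N)
        (fun w A => if B n w then phi A else Q (X n w) A) &
      cond_law (Pr x) (attempt_at n)
        (fun w => (history n w, B n w, X (n + m)%N w)) (intermediate n)
        (fun w => K (X n w, X (n + m)%N w))].

(* The value 0 on the event tau = +oo is immaterial: under the drift and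
   minorization conditions that event is P_x-negligible. *)
Definition gstar (h : S -> \bar R) (x : S) : \bar R :=
  \int[Pr x]_w (if tau C m (X ^~ w) (B ^~ w) is Some t
                then \sum_(0 <= j < t) h (X j w) else 0).

End split_chain.

(* Main.v *)
Require Import Defs.
From HB Require Import structures.
From mathcomp Require Import all_boot all_order all_algebra.
From mathcomp Require Import all_classical all_reals all_analysis.
From mathcomp Require Import measurable_realfun.
From mathcomp Require Import zify ring lra.

(** Let M_n(x, .) be the law of X_n under P_x on the event n < tau, and p_n(x)
    the probability of tau = n + 1.  The coins and the residual kernel average
    out inside a block, so that M_0 is the identity and
    M_n P = M_(n+1) + p_n phi.  Every attempt succeeds with probability lambda
    and every visit to C before tau falls within m steps of an attempt, whence
    sum_n M_n(x, C) <= m / lambda, and the drift conditions bound U f and U 1,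
    where U = sum_n M_n.  The measure phi U is finite and invariant, so by
    uniqueness it is a multiple of pi, and phi U (f - pi f) = 0.

    For m > 1 the function g* = U (f - pi f) cannot be handled by conditioning
    on the first step, because the chain restarted from X_1 splits at other
    times.  Instead let w_r >= 0 solve the discounted equation
    w_r = f + r P w_r.  Telescoping r^n M_n w_r gives, with
    beta_r = (1 - r) phi(w_r),
      w_r - phi(w_r) = sum_n r^n M_n (f - beta_r).
    Integrating against phi shows that beta_r converges to pi f as r -> 1, so the
    right-hand side converges to g*, while the left-hand side g_r satisfies
    g_r = f - beta_r + r P g_r; dominated convergence then yields the claim. *)

Import Order.TTheory GRing.Theory Num.Theory.
Import numFieldNormedType.Exports.

Local Open Scope classical_set_scope.
Local Open Scope ring_scope.
Local Open Scope ereal_scope.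

(** * Attempt times of a trajectory *)

Lemma firstP (A : set nat) :
  match first A with
  | Some n => A n /\ (forall k, (k < n)%N -> ~ A k)
  | None => forall n, ~ A n
  end.
Proof.
rewrite /first; case: pselect => [exA|nex].
  case: ex_minnP => n /[!inE] An minn; split=> // k kn Ak.
  by have := minn k (mem_set Ak); rewrite leqNgt kn.
by move=> n An; apply: nex; exists n; rewrite inE.
Qed.

Section attempts.
Context {S : Type} (C : set S) (m : nat) (m1 : (1 <= m)%N).
Implicit Types (xs : nat -> S) (bs : nat -> bool).

Lemma attemptS_ge xs i t s : attempt C m xs i = Some t ->
  attempt C m xs i.+1 = Some s -> (t + m <= s)%N.
Proof.
move=> /= ->/=; move: (firstP [set n | (t + m <= n)%N /\ C (xs n)]).
by case: first => // n [[tn _] _] [<-].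
Qed.

Lemma attempt_gap xs i j t s : attempt C m xs i = Some t ->
  attempt C m xs j = Some s -> (i < j)%N -> (t + m <= s)%N.
Proof.
move=> it; elim: j s => // j ih s js; rewrite ltnS leq_eqVlt => /orP[/eqP ij|ij].
  by subst j; exact: (attemptS_ge _ _ _ _ it js).
case ju: (attempt C m xs j) => [u|]; last by move: js; rewrite /= ju.
by have := ih _ ju ij; have := attemptS_ge _ _ _ _ ju js; lia.
Qed.

Lemma attempt_geq xs i t : attempt C m xs i = Some t -> (i <= t)%N.
Proof.
elim: i t => // i ih t it.
case iu: (attempt C m xs i) => [u|]; last by move: it; rewrite /= iu.
by have := ih _ iu; have := attemptS_ge _ _ _ _ iu it; lia.
Qed.

Lemma attempt_C xs i t : attempt C m xs i = Some t -> C (xs t).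
Proof.
case: i => [|i] /=; first by move: (firstP [set n | C (xs n)]);
  case: first => // n [Cn _] [<-].
case: (attempt C m xs i) => //= u.
move: (firstP [set n | (u + m <= n)%N /\ C (xs n)]).
by case: first => // n [[_ Cn] _] [<-].
Qed.

Lemma is_attempt_gap xs t s : is_attempt C m xs t -> is_attempt C m xs s ->
  (t < s)%N -> (t + m <= s)%N.
Proof.
move=> [i it] [j js] ts; apply: (attempt_gap _ _ _ _ _ it js).
rewrite ltnNge leq_eqVlt; apply/negP => /orP[/eqP ij|ji].
  by move: ts; subst j; rewrite it in js; case: js => ->; rewrite ltnn.
by have := attempt_gap _ _ _ _ _ js it ji; lia.
Qed.

(** A criterion free of the index [i]: it gives measurability of the attempt events by induction on
    [n], and shows that a visit to [C] outside all blocks is itself an attempt. *)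
Lemma is_attemptE xs n : is_attempt C m xs n <->
  C (xs n) /\ forall t, (t < n)%N -> (n < t + m)%N -> ~ is_attempt C m xs t.
Proof.
split=> [an|[Cn nat_]].
  split=> [|t tn ntm at_]; first by case: an => i /attempt_C.
  by have := is_attempt_gap _ _ _ at_ an tn; lia.
apply: contrapT => nan.
(* If [n] were not an attempt time, every attempt would exist and precede [n], since the visit at
   [n] is a candidate for each next infimum. Attempt number [n] then contradicts [attempt_geq]. *)
have lt_n i : exists2 t, attempt C m xs i = Some t & (t < n)%N.
  elim: i => [|i [u iu un]].
    case E: (attempt C m xs 0) => [t|].
      exists t => //; rewrite ltnNge; apply/negP => nt.
      move: (firstP [set n | C (xs n)]); move: (E) => /= -> [_ tmin].
      move: nt; rewrite leq_eqVlt => /orP[/eqP nt|nt]; last exact: (tmin n).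
      by apply: nan; exists 0%N; rewrite nt.
    by move: (firstP [set n | C (xs n)]); move: (E) => /= -> /(_ n).
  have umn : (u + m <= n)%N.
    rewrite leqNgt; apply/negP => num; apply: (nat_ u un num); by exists i.
  case E: (attempt C m xs i.+1) => [t|].
    exists t => //; rewrite ltnNge; apply/negP => nt.
    move: (E); rewrite /= iu /= => E'.
    move: (firstP [set n | (u + m <= n)%N /\ C (xs n)]); rewrite E' => -[_ tmin].
    move: nt; rewrite leq_eqVlt => /orP[/eqP nt|nt]; last exact: (tmin n).
    by apply: nan; exists i.+1; rewrite nt.
  move: (E); rewrite /= iu /= => E'.
  by move: (firstP [set n | (u + m <= n)%N /\ C (xs n)]); rewrite E' => /(_ n) [].
have [t nt tn] := lt_n n.
by have := attempt_geq _ _ _ nt; lia.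
Qed.

(* Equivalent to [n < tau], see [tauP]. *)
Definition alive xs bs n :=
  forall t, is_attempt C m xs t -> bs t -> (n < t + m)%N.

Definition no_success xs bs n :=
  forall t, (t < n)%N -> is_attempt C m xs t -> ~~ bs t.

(** Attempts are at least [m] apart, so among the bounds [n < t + m] imposed by the successes, the
    one from the first success implies all others. *)
Lemma tauP xs bs :
  match tau C m xs bs with
  | Some s => forall n, alive xs bs n <-> (n < s)%N
  | None => forall n, alive xs bs n
  end.
Proof.
rewrite /tau /first_success.
move: (firstP [set i | exists2 t, attempt C m xs i = Some t & bs t]).
case: first => [i [[t it bt] imin]|none] /=.
  rewrite it /= => n; split=> [|nt s [j js] bsj]; first by apply; [exists i|].
  have ij : (i <= j)%N by rewrite leqNgt; apply/negP => /imin; apply; exists s.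
  move: ij; rewrite leq_eqVlt => /orP[/eqP ij|ij].
    by subst j; rewrite it in js; case: js => <-.
  by have := attempt_gap _ _ _ _ _ it js ij; lia.
by move=> n t [i it] bt; case: (none i); exists t.
Qed.

(** A success at [t] takes effect only at [t + m], so within the block of [t] survival puts no
    condition on the coin of [t] itself. Each alternative is decided by what has been generated on
    reaching [n], respectively [t], which is where the construction prescribes the conditional
    laws. *)
Lemma aliveP xs bs n : alive xs bs n <->
  (is_free C m xs n /\ no_success xs bs n) \/
  (exists t, [/\ (t <= n)%N, (n < t + m)%N, is_attempt C m xs t &
                 no_success xs bs t]).
Proof.
split=> [al|[[free ns]|[t [tn ntm at_ ns]]] s as_ bs_].
- case: (pselect (exists t, [/\ (t <= n)%N, (n < t + m)%N & is_attempt C m xs t])).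
    move=> [t [tn ntm at_]]; right; exists t; split=> // s st as_.
    apply/negP => bs_; have := al s as_ bs_.
    by have := is_attempt_gap _ _ _ as_ at_ st; lia.
  move=> nex; left; split=> [i t it /andP[tn ntm]|t tn at_].
    by apply: nex; exists t; split=> //; exists i.
  apply/negP => bt; apply: nex; exists t; split; [exact: ltnW|exact: al|by []].
- have ns' : (n <= s)%N.
    rewrite leqNgt; apply/negP => sn; by have := ns s sn as_; rewrite bs_.
  by lia.
- have ts : (t <= s)%N.
    rewrite leqNgt; apply/negP => st; by have := ns s st as_; rewrite bs_.
  by lia.
Qed.

(** A success compatible with survival at [n] but not at [n.+1] sits exactly at [n.+1 - m]. The
    clause [no_success] comes for free: an earlier success would have ended survival by time
    [t <= n]. *)
Lemma aliveS xs bs n : alive xs bs n ->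
  (alive xs bs n.+1 <->
   ~ exists t, [/\ (n.+1 = t + m)%N, is_attempt C m xs t, no_success xs bs t &
                   bs t]).
Proof.
move=> al; split=> [al' [t [tn at_ _ bt]]|nex t at_ bt].
  by have := al' t at_ bt; lia.
have ntm := al t at_ bt; rewrite ltn_neqAle ntm andbT; apply/negP => /eqP tn.
apply: nex; exists t; split=> // s st as_; apply/negP => bs_.
by have := al s as_ bs_; have := is_attempt_gap _ _ _ as_ at_ st; lia.
Qed.

Lemma alive_pred xs bs n : alive xs bs n.+1 -> alive xs bs n.
Proof. by move=> al t at_ bt; have := al t at_ bt; lia. Qed.

End attempts.

(** * Kernels and images of measures *)

Section image_measure.
Context {R : realType} {d1 d2 : measure_display}.
Context {T1 : measurableType d1} {T2 : measurableType d2}.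

Definition image_measure (mu : {measure set T1 -> \bar R}) (f : T1 -> T2)
  (mf : measurable_fun setT f) : {measure set T2 -> \bar R}.
Proof. by refine (pushforward mu f : {measure set T2 -> \bar R}). Defined.

Lemma integral_image_measure (mu : {measure set T1 -> \bar R}) (f : T1 -> T2)
    (mf : measurable_fun setT f) (h : T2 -> \bar R) :
  measurable_fun setT h -> (forall y, 0 <= h y) ->
  \int[image_measure mu f mf]_y h y = \int[mu]_x h (f x).
Proof. by move=> mh h0; rewrite (ge0_integral_pushforward mf). Qed.

Lemma integral_mrestr (mu : {measure set T1 -> \bar R}) E
    (mE : measurable E) (h : T1 -> \bar R) :
  measurable_fun setT h -> (forall y, 0 <= h y) ->
  \int[mrestr mu mE]_x h x = \int[mu]_(x in E) h x.
Proof.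
move=> mh h0.
rewrite [LHS](ge0_negligible_integral (N := ~` E))//; last 2 first.
- exact: measurableC.
- by rewrite /= /mrestr setICl measure0.
rewrite setDE setTI setCK; apply: eq_measure_integral => A mA AE.
by rewrite /= /mrestr (setIidl AE).
Qed.

End image_measure.

Section restricted_law.
Context {R : realType} {d d1 dO : measure_display}.
Context {S : measurableType d} {T : measurableType d1} {Omega : measurableType dO}.
Variables (Pr : R.-pker S ~> Omega) (E : set Omega) (mE : measurable E).
Variable (Y : {mfun Omega >-> T}).

(** A subprobability kernel whose missing mass is the probability of the complement of [E]. With [E]
    the event [n < tau] and [Y] the state at time [n] it is the kernel [M_n]. *)
Definition klaw (x : S) : {measure set T -> \bar R} :=
  image_measure (mrestr (Pr x) mE) Y (@measurable_funPT _ _ _ _ Y).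

Lemma klawE x A : klaw x A = Pr x (E `&` Y @^-1` A).
Proof. by rewrite /klaw /= /pushforward /mrestr setIC. Qed.

Let measurable_klaw U : measurable U -> measurable_fun setT (klaw ^~ U).
Proof.
move=> mU; under eq_fun do rewrite klawE.
by apply: measurable_kernel; apply: measurableI => //; exact: measurable_funPTI.
Qed.

HB.instance Definition _ := isKernel.Build _ _ _ _ _ klaw measurable_klaw.

Let klaw_le1 : ereal_sup [set klaw x [set: T] | x in [set: S]] <= 1.
Proof.
apply: (sprob_kernelP klaw).2 => x.
rewrite klawE preimage_setT setIT -(prob_kernel (s := Pr) x).
by apply: le_measure => //; rewrite inE.
Qed.

HB.instance Definition _ := Kernel_isSubProbability.Build _ _ _ _ _ klaw klaw_le1.

Lemma integral_klaw x (h : T -> \bar R) : measurable_fun setT h ->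
  (forall y, 0 <= h y) -> \int[klaw x]_y h y = \int[Pr x]_(w in E) h (Y w).
Proof.
move=> mh h0; rewrite integral_image_measure// integral_mrestr//.
exact: measurableT_comp.
Qed.

End restricted_law.

Section constant_kernel.
Context {R : realType} {d d' : measure_display}.
Context {T : measurableType d} {T' : measurableType d'}.
Variable mu : {measure set T' -> \bar R}.

(** The bound is an argument so that the term carries what the subprobability structure needs. With
    a one-point source, a measure becomes a kernel that can be composed. *)
Definition kcst (mu1 : mu setT <= 1) (x : T) : {measure set T' -> \bar R} := mu.

Hypothesis mu1 : mu setT <= 1.

Let measurable_kcst U : measurable U -> measurable_fun setT (kcst mu1 ^~ U).
Proof. by move=> _; exact: measurable_cst. Qed.

HB.instance Definition _ := isKernel.Build _ _ _ _ _ (kcst mu1) measurable_kcst.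

Let kcst_le1 : ereal_sup [set kcst mu1 x setT | x in setT] <= 1.
Proof. exact: (sprob_kernelP (kcst mu1)).2. Qed.

HB.instance Definition _ := Kernel_isSubProbability.Build _ _ _ _ _ (kcst mu1) kcst_le1.
End constant_kernel.

Section graph_kernel.
Context {R : realType} {d1 d2 : measure_display}.
Context {T1 : measurableType d1} {T2 : measurableType d2}.
Variable k : R.-spker T1 ~> T2.

(** Keeps the starting point, so that composition with the law of a variable yields a joint law of
    pairs. *)
Definition kgraph (z : T1) : {measure set (T1 * T2) -> \bar R} :=
  image_measure (k z) (pair z) (pair1_measurable z).

Let measurable_kgraph U : measurable U -> measurable_fun setT (kgraph ^~ U).
Proof.
move=> mU; apply: (eq_measurable_fun (fun z => k z (xsection U z))).
  by move=> z _; rewrite xsectionE.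
by apply: measurable_fun_xsection_finite_kernel; rewrite inE.
Qed.

HB.instance Definition _ := isKernel.Build _ _ _ _ _ kgraph measurable_kgraph.

Let kgraph_le1 : ereal_sup [set kgraph z setT | z in setT] <= 1.
Proof.
by apply: (sprob_kernelP kgraph).2 => z; exact: sprob_kernel_le1.
Qed.

HB.instance Definition _ := Kernel_isSubProbability.Build _ _ _ _ _ kgraph kgraph_le1.
End graph_kernel.

Lemma integral_mkcomp_noparam {R : realType} {d0 d1 d2 : measure_display}
  {T0 : measurableType d0} {T1 : measurableType d1} {T2 : measurableType d2}
  (l : R.-spker T0 ~> T1) (k : R.-spker T1 ~> T2) x (h : T2 -> \bar R) :
  (forall z, 0 <= h z) -> measurable_fun setT h ->
  \int[mkcomp_noparam l k x]_z h z = \int[l x]_y \int[k y]_z h z.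
Proof.
move=> h0 mh; rewrite -(integral_kcomp l (kernel.kernel_snd k) x)//.
Qed.

(** The hypothesis says that two finite measures on the product, the law of [(Z, Y)] on [E] and the
    composition of the law of [Z] with [k], agree on rectangles. Rectangles are stable under
    intersection and generate, so the measures are equal and have the same integrals. *)
Lemma disintegration {R : realType} {d1 d2 dO : measure_display}
  {T1 : measurableType d1} {T2 : measurableType d2} {Omega : measurableType dO}
  (mu : {measure set Omega -> \bar R}) (mu1 : mu setT <= 1)
  (E : set Omega) (mE : measurable E)
  (Z : {mfun Omega >-> T1}) (Y : {mfun Omega >-> T2}) (k : R.-spker T1 ~> T2) :
  (forall A B, measurable A -> measurable B ->
    mu (E `&` Z @^-1` A `&` Y @^-1` B) = \int[mu]_(w in E `&` Z @^-1` A) k (Z w) B) ->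
  forall F : T1 * T2 -> \bar R, (forall u, 0 <= F u) -> measurable_fun setT F ->
  \int[mu]_(w in E) F (Z w, Y w) = \int[mu]_(w in E) \int[k (Z w)]_y F (Z w, y).
Proof.
move=> law F F0 mF.
have mZ : measurable_fun setT Z by [].
have mY : measurable_fun setT Y by [].
have mZY : measurable_fun setT (fun w => (Z w, Y w)) by exact: measurable_fun_pair.
have lZ1 : image_measure (mrestr mu mE) Z mZ setT <= 1.
  rewrite /= /pushforward /mrestr preimage_setT setTI.
  by apply: le_trans mu1; apply: le_measure; rewrite ?inE.
pose lZ : R.-spker unit ~> T1 := kcst _ lZ1.
pose m1 := image_measure (mrestr mu mE) _ mZY.
pose m2 := mkcomp_noparam lZ (kgraph k) tt.
have m12 : forall A, measurable A -> m1 A = m2 A.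
  apply: (measure_unique [set A `*` B | A in measurable & B in measurable] (fun=> setT)).
  - by rewrite measurable_prod_measurableType.
  - move=> _ _ [A1 mA1 [B1 mB1 <-]] [A2 mA2 [B2 mB2 <-]]; rewrite -setXI.
    by exists (A1 `&` A2); [exact: measurableI|]; exists (B1 `&` B2);
      [exact: measurableI|].
  - by move=> _; exists setT => //; exists setT => //; rewrite setXTT.
  - by rewrite bigcup_const.
  - move=> _ [A mA [B mB <-]].
    rewrite /m1 /= /pushforward /mrestr.
    transitivity (mu (E `&` Z @^-1` A `&` Y @^-1` B)).
      by congr (mu _); apply/seteqP; split=> w /=; tauto.
    rewrite law// /m2 /= /kcomp_noparam /= integral_image_measure; last 2 first.
      exact: measurable_kernel (kgraph k) _ (measurableX mA mB).
      by move=> z; exact: measure_ge0.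
    rewrite integral_mrestr//; last 2 first.
      exact: (measurableT_comp (measurable_kernel (kgraph k) _ (measurableX mA mB)) mZ).
      by move=> w; exact: (measure_ge0 (kgraph k (Z w))).
    rewrite integral_mkcondr; apply: eq_integral => w _.
    rewrite patchE /= /pushforward; case: ifPn => [|/negP]; rewrite inE /= => ZA.
      by congr (k _ _); apply/seteqP; split=> y //= [].
    by rewrite (_ : _ @^-1` _ = set0) ?measure0//; apply/seteqP; split=> y //= [].
  - exact: mZ.
  - by move=> _; exact: le_lt_trans lZ1 (ltry _).
have mFk z : measurable_fun setT (fun y => F (z, y)).
  by apply: measurableT_comp => //; exact: pair1_measurable.
have mIF : measurable_fun setT (fun z => \int[k z]_y F (z, y)).
  apply: (eq_measurable_fun (fun z => \int[kgraph k z]_u F u)).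
    by move=> z _; rewrite integral_image_measure.
  apply: measurable_fun_integral_kernel => // U mU.
  exact: (measurable_kernel (kgraph k)).
transitivity (\int[m1]_u F u).
  by rewrite integral_image_measure// integral_mrestr//; exact: measurableT_comp.
rewrite (eq_measure_integral m2); last by move=> A mA _; exact: m12.
rewrite integral_mkcomp_noparam//.
under eq_integral do rewrite integral_image_measure//.
rewrite integral_image_measure//; last by move=> z; exact: integral_ge0.
rewrite integral_mrestr//; first exact: measurableT_comp mIF mZ.
by move=> w; exact: integral_ge0.
Qed.

(** * Series and the discounted equation *)

Lemma adde_fin_inj {R : realDomainType} (t x y : \bar R) :
  t \is a fin_num -> t + x = t + y -> x = y.
Proof.
move=> tf E; apply/eqP; rewrite eq_le.
by rewrite -(@leeD2lE _ t x y)// -[X in _ && X](@leeD2lE _ t y x)// E lexx.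
Qed.

Lemma nneseriesS {R : realType} (u : nat -> \bar R) : (forall n, 0 <= u n) ->
  \sum_(n <oo) u n = u 0%N + \sum_(n <oo) u n.+1.
Proof.
move=> u0; rewrite nneseries_recl// -(nneseries_addn 1)//.
by congr (_ + _); apply: eq_eseriesr => n _; rewrite addn1.
Qed.

(** The easy half of Abel's theorem: for nonnegative terms it is monotone convergence for the
    counting measure. *)
Lemma abel_cvg {R : realType} (r : nat -> R) (a : nat -> \bar R) :
  (forall k, 0 <= r k)%R -> {homo r : m n / (m <= n)%N >-> (m <= n)%R} ->
  r k @[k --> \oo] --> (1 : R)%R ->
  (forall n, 0 <= a n) -> (forall n, a n \is a fin_num) ->
  \sum_(n <oo) (r k ^+ n)%:E * a n @[k --> \oo] --> \sum_(n <oo) a n.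
Proof.
move=> r0 rnd r1 a0 afin.
have ra0 k n : 0 <= (r k ^+ n)%:E * a n by rewrite mule_ge0// lee_fin exprn_ge0.
under eq_fun do rewrite -ge0_integral_count//.
rewrite -ge0_integral_count//.
have -> : \int[counting]_n a n =
    \int[counting]_n limn (fun k => (r k ^+ n)%:E * a n).
  apply: eq_integral => n _; apply/esym/cvg_lim => //.
  have rn : (r k ^+ n)%R @[k --> \oo] --> (1 ^+ n : R)%R.
    by apply: (@cvg_comp _ _ _ r (fun z : R =>
      (z ^+ n)%R) _ _ _ r1 (@exprn_continuous R n 1%R)).
  rewrite expr1n in rn.
  have rnE : (r k ^+ n)%:E @[k --> \oo] --> 1%:E by apply: cvg_EFin; [exact: nearW|].
  by have := cvgeZr (afin n) rnE; rewrite mul1e.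
apply: cvg_monotone_convergence => //.
move=> n _ i j ij; apply: lee_wpmul2r => //; rewrite lee_fin.
by apply: lerXn2r; rewrite ?nnegrE//; exact: rnd.
Qed.

(** Any sequence increasing to 1 would do; the shift by 2 keeps it strictly between 0 and 1 already
    at [k = 0]. *)
Definition discount {R : realType} (k : nat) : R := (1 - k.+2%:R^-1)%R.

Lemma discount_itv {R : realType} k : (0 < @discount R k < 1)%R.
Proof.
rewrite /discount subr_gt0 invf_lt1// ltr1n/= ltrBlDr ltrDl invr_gt0//.
Qed.

Lemma discount_nd {R : realType} :
  {homo @discount R : m n / (m <= n)%N >-> (m <= n)%R}.
Proof. by move=> m n mn; rewrite lerB// lef_pV2 ?posrE// ler_nat. Qed.

Lemma discount_cvg {R : realType} : @discount R k @[k --> \oo] --> (1 : R)%R.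
Proof.
suff : (1 - k.+2%:R^-1 : R)%R @[k --> \oo] --> (1 - 0 : R)%R by rewrite subr0.
apply: cvgB; first exact: cvg_cst.
by rewrite (cvg_shiftS (fun k => k.+1%:R^-1 : R)%R); exact: cvg_harmonic.
Qed.

Lemma nneseries_term_le {R : realType} (u : nat -> \bar R) n :
  (forall k, 0 <= u k) -> u n <= \sum_(k <oo) u k.
Proof.
move=> u0; apply: (@le_trans _ _ (\sum_(0 <= k < n.+1) u k)).
  by rewrite big_nat_recr//= leeDr// sume_ge0.
exact: nneseries_lim_ge.
Qed.

Lemma nneseries_term_fin {R : realType} (u : nat -> \bar R) n :
  (forall k, 0 <= u k) -> \sum_(k <oo) u k < +oo -> u n \is a fin_num.
Proof.
move=> u0 fin; rewrite ge0_fin_numE//.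
exact: le_lt_trans (nneseries_term_le u n u0) fin.
Qed.

Lemma nneseries_fine_cvg {R : realType} (u : nat -> \bar R) :
  (forall k, 0 <= u k) -> \sum_(k <oo) u k < +oo ->
  (\sum_(0 <= k < n) fine (u k))%R @[n --> \oo] --> fine (\sum_(k <oo) u k).
Proof.
move=> u0 fin.
have tfin : \sum_(k <oo) u k \is a fin_num by rewrite ge0_fin_numE// nneseries_ge0.
have cu : \sum_(0 <= k < n) u k @[n --> \oo] --> (fine (\sum_(k <oo) u k))%:E.
  by rewrite fineK//; exact: is_cvg_nneseries.
have E n : (\sum_(0 <= k < n) fine (u k))%R = fine (\sum_(0 <= k < n) u k).
  by rewrite sum_fine// => k _; exact: nneseries_term_fin.
under eq_fun do rewrite E.
exact: fine_cvg cu.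
Qed.

(** The partial sums equal [Z 0 - r ^+ n * Z n], and the remainder is at most [K * r ^+ n]. *)
Lemma discounted_telescope {R : realType} (r K : R) (Z a : nat -> R) :
  (0 <= r < 1)%R -> (forall n, Z n = a n + r * Z n.+1)%R ->
  (forall n, `|Z n| <= K)%R ->
  (\sum_(0 <= k < n) r ^+ k * a k)%R @[n --> \oo] --> Z 0%N.
Proof.
move=> /andP[r0 r1] ZE ZK.
have sumE n : (\sum_(0 <= k < n) r ^+ k * a k = Z 0%N - r ^+ n * Z n)%R.
  elim: n => [|n ih]; first by rewrite big_geq// expr0 mul1r subrr.
  by rewrite big_nat_recr//= ih (ZE n) exprSr; ring.
under eq_fun do rewrite sumE.
suff : (Z 0%N - r ^+ n * Z n)%R @[n --> \oo] --> (Z 0%N - 0)%R by rewrite subr0.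
apply: cvgB; first exact: cvg_cst.
have rK : (K * r ^+ n)%R @[n --> \oo] --> (0 : R)%R.
  rewrite -(mulr0 K); apply: cvgM; first exact: cvg_cst.
  by apply: cvg_expr; rewrite ger0_norm.
have nrK : (- (K * r ^+ n))%R @[n --> \oo] --> (0 : R)%R.
  by rewrite -oppr0; exact: cvgN.
apply: (squeeze_cvgr _ nrK rK).
apply: nearW => n; rewrite -ler_norml normrM ger0_norm ?exprn_ge0// mulrC.
by apply: ler_wpM2r => //; exact: exprn_ge0.
Qed.

(** The solution is the increasing limit of the iterates of [g |-> h + r P g] from 0, kept finite by
    a supersolution built from the drift function. *)
Lemma resolvent {R : realType} {d : measure_display} {S : measurableType d}
    (P : R.-pker S ~> S) (C : set S) (v h : S -> R) (b r : R) :
  (0 <= b)%R -> (0 < r < 1)%R ->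
  measurable_fun setT v -> measurable_fun setT h ->
  (forall x, 0 <= v x)%R -> (forall x, 0 <= h x)%R ->
  (forall x, \int[P x]_y (v y)%:E <= (v x - h x + b * \1_C x)%:E) ->
  exists w : S -> R, [/\ measurable_fun setT w, forall x, (0 <= w x)%R,
    forall x, (w x <= r^-1 * v x + b / (1 - r))%R &
    forall x, (w x)%:E = (h x)%:E + r%:E * \int[P x]_y (w y)%:E].
Proof.
move=> b0 /andP[r0 r1] mv mh v0 h0 dr.
have r1' : (0 < 1 - r)%R by rewrite subr_gt0.
pose T (g : S -> \bar R) x := (h x)%:E + r%:E * \int[P x]_y g y.
(* The supersolution: [r^-1] cancels the discount in front of [P v], so that the drift inequality
   applies, and the constant [b / (1 - r)] loses exactly [b] under [r P], which absorbs the term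
   [b * \1_C]. *)
pose W x : \bar R := (r^-1 * v x + b / (1 - r))%:E.
have mPg g : measurable_fun setT g -> (forall x, 0 <= g x) ->
    measurable_fun setT (fun x => \int[P x]_y g y).
  move=> mg g0; apply: measurable_fun_integral_kernel => // U mU.
  exact: measurable_kernel.
have mW : measurable_fun setT W.
  by apply/measurable_EFinP; apply: measurable_funD => //; exact: measurable_funM.
have k0 : (0 <= b / (1 - r))%R by rewrite divr_ge0// ltW.
have W0 x : 0 <= W x.
  by rewrite lee_fin addr_ge0// mulr_ge0// invr_ge0 ltW.
have Tge0 g : (forall x, 0 <= g x) -> forall x, 0 <= T g x.
  move=> g0 x; apply: adde_ge0; first by rewrite lee_fin.
  by apply: mule_ge0; [rewrite lee_fin ltW|exact: integral_ge0].
have Tm g : measurable_fun setT g -> (forall x, 0 <= g x) -> measurable_fun setT (T g).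
  move=> mg g0; apply: emeasurable_funD; first exact/measurable_EFinP.
  by apply: measurable_funeM; exact: mPg.
have Tle g1 g2 : measurable_fun setT g1 -> measurable_fun setT g2 ->
    (forall x, 0 <= g1 x) -> (forall x, g1 x <= g2 x) -> forall x, T g1 x <= T g2 x.
  move=> mg1 mg2 g10 g12 x; apply: leeD2l; apply: lee_wpmul2l;
    first by rewrite lee_fin ltW.
  exact: ge0_le_integral.
have TW x : T W x <= W x.
  rewrite /T.
  have -> : \int[P x]_y W y = r^-1%:E * \int[P x]_y (v y)%:E + (b / (1 - r))%:E.
    rewrite /W; under eq_integral do rewrite EFinD EFinM.
    have ri0 : (0 <= r^-1)%R by rewrite invr_ge0 ltW.
    have vE0 (y : S) : setT y -> 0 <= (v y)%:E by rewrite lee_fin.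
    have rvE0 (y : S) : setT y -> 0 <= r^-1%:E * (v y)%:E by move=> _;
      rewrite mule_ge0 ?lee_fin.
    have mvE : measurable_fun setT (EFin \o v) by exact/measurable_EFinP.
    have mrvE : measurable_fun setT (fun y =>
      r^-1%:E * (v y)%:E) by exact: measurable_funeM.
    rewrite ge0_integralD// ge0_integralZl_EFin//.
    by rewrite integral_cst// [P x setT]prob_kernel mule1.
  have := dr x; have : 0 <= \int[P x]_y (v y)%:E.
    by apply: integral_ge0 => y _; rewrite lee_fin.
  case: (\int[P x]_y (v y)%:E) => // I _; rewrite !lee_fin => I1.
  have C1 : (b * \1_C x <= b)%R by rewrite ler_piMr// indicE lern1 leq_b1.
  have -> : (h x + r * (r^-1 * I + b / (1 - r)) = h x + I + b / (1 - r) - b)%R.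
    by field; rewrite gt_eqF// gt_eqF.
  have v1 : (v x <= r^-1 * v x)%R by rewrite ler_peMl// invf_ge1// ltW.
  by lra.
pose wn n := iter n T (cst 0).
have wnm n : measurable_fun setT (wn n) /\ (forall x, 0 <= wn n x).
  elim: n => [|n [ihm ih0]]; first by split.
  by split; [exact: Tm|exact: Tge0].
have wnS n x : wn n x <= wn n.+1 x.
  elim: n x => [|n ih] x; first by have [_] := wnm 1%N; exact.
  by have [] := wnm n; have [] := wnm n.+1; move=> *; exact: Tle.
have wnW n x : wn n x <= W x.
  elim: n x => [|n ih] x; first exact: W0.
  by apply: le_trans (TW x); have [] := wnm n; move=> *; exact: Tle.
have nd x : {homo wn ^~ x : n m / (n <= m)%N >-> n <= m}.
  by apply/nondecreasing_seqP => n; exact: wnS.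
have cv x : wn n x @[n --> \oo] --> limn (wn ^~ x).
  exact: ereal_nondecreasing_is_cvgn.
pose wl x := limn (wn ^~ x).
have wl0 x : 0 <= wl x by apply: lime_ge; [exact: cv|apply: nearW => n;
  apply: (wnm n).2].
have wlW x : wl x <= W x by apply: lime_le; [exact: cv|exact: nearW].
have wlfin x : wl x \is a fin_num.
  by rewrite ge0_fin_numE//; apply: le_lt_trans (wlW x) (ltry _).
have mwl : measurable_fun setT wl.
  by apply: (emeasurable_fun_cvg wn) => [n|x _]; [exact: (wnm n).1|exact: cv].
exists (fine \o wl); split.
- exact: measurableT_comp.
- by move=> x; rewrite fine_ge0.
- by move=> x; rewrite -lee_fin fineK.
move=> x /=; rewrite fineK//.
under eq_integral do rewrite fineK//.
have c1 : wn n.+1 x @[n --> \oo] --> wl x.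
  by have := cv x; rewrite -(cvg_shiftS (wn ^~ x)).
have c2 : (h x)%:E + r%:E * \int[P x]_y wn n y @[n --> \oo] -->
    (h x)%:E + r%:E * \int[P x]_y wl y.
  apply: cvgeD; [by []|exact: cvg_cst|].
  apply: cvgeZl => //; apply: cvg_monotone_convergence => //.
  - by move=> n; exact: (wnm n).1.
  - by move=> n y _; exact: (wnm n).2.
exact: (cvg_unique _ c1 c2).
Qed.

(** * Chains killed at a regeneration time *)

Section killed_chain.
Context {R : realType} {d : measure_display} {S : measurableType d}.
Variables (P : R.-pker S ~> S) (M : nat -> R.-spker S ~> S).
Variables (p : nat -> S -> \bar R) (phi : probability S R).
Variables (C : set S) (mC : measurable C) (c : R).
Hypothesis p_ge0 : forall n x, 0 <= p n x.
Hypothesis M0 : forall x A, measurable A -> M 0 x A = \d_x A.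
Hypothesis M_step : forall n x A, measurable A ->
  \int[M n x]_y P y A = M n.+1 x A + p n x * phi A.
Hypothesis M_C : forall x, \sum_(n <oo) M n x C <= c%:E.

Lemma M_mass n x : M n x setT = M n.+1 x setT + p n x.
Proof.
transitivity (\int[M n x]_y P y setT); last by rewrite M_step// probability_setT mule1.
under eq_integral do rewrite prob_kernel.
by rewrite integral_cst// mul1e.
Qed.

Lemma p_fin n x : p n x \is a fin_num.
Proof.
rewrite ge0_fin_numE//; apply: (le_lt_trans _ (ltry 1%R)).
by rewrite -(leeD2lE (x := 0))// !add0e;
  apply: (le_trans _ (sprob_kernel_le1 (M n) x)); rewrite M_mass leeDr.
Qed.

(** [M_step] identifies the measure [M_n P] with [M_(n+1) + p_n phi] on measurable sets, hence also
    under the integral. *)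
Lemma integral_M_step n x (h : S -> \bar R) :
  measurable_fun setT h -> (forall y, 0 <= h y) ->
  \int[M n x]_y \int[P y]_z h z =
  \int[M n.+1 x]_y h y + p n x * \int[phi]_y h y.
Proof.
move=> mh h0; have q0 : (0 <= fine (p n x))%R by rewrite fine_ge0.
rewrite -integral_mkcomp_noparam//.
rewrite (eq_measure_integral (measure_add (M n.+1 x) (mscale (NngNum q0) phi))).
  rewrite ge0_integral_measure_add// ge0_integral_mscale//=.
  by rewrite fineK ?p_fin.
move=> A mA _; rewrite [RHS]measure_addE /= /mscale/= fineK ?p_fin//.
exact: M_step.
Qed.

(** * Bounds obtained from a drift inequality *)

Section drift.
Variables (v h : S -> R) (b : R) (b0 : (0 <= b)%R).
Hypothesis mv : measurable_fun setT v.
Hypothesis mh : measurable_fun setT h.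
Hypothesis v0 : forall x, (0 <= v x)%R.
Hypothesis h0 : forall x, (0 <= h x)%R.
Hypothesis drift : forall x,
  \int[P x]_y (v y)%:E <= (v x - h x + b * \1_C x)%:E.

Let mEv : measurable_fun setT (EFin \o v). Proof. exact/measurable_EFinP. Qed.
Let mEh : measurable_fun setT (EFin \o h). Proof. exact/measurable_EFinP. Qed.
Let mPv : measurable_fun setT (fun x => \int[P x]_y (v y)%:E).
Proof.
apply: measurable_fun_integral_kernel => // U mU; exact: measurable_kernel.
Qed.

(** The drift inequality integrated against [M n x], with [h] moved to the left so that nothing
    possibly infinite is subtracted. The regeneration term is kept because [integral_phi_fin]
    extracts [phi v] from it. *)
Lemma drift_step n x :
  \int[M n x]_y (h y)%:E + \int[M n.+1 x]_y (v y)%:E + p n x * \int[phi]_y (v y)%:E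
  <= \int[M n x]_y (v y)%:E + b%:E * M n x C.
Proof.
have mC1 : measurable_fun setT (fun y => (\1_C y : R)%:E).
  by apply/measurable_EFinP; exact: measurable_indic.
rewrite -addeA -integral_M_step//.
have -> : M n x C = \int[M n x]_y (\1_C y)%:E by rewrite integral_indic// setIT.
have C0 (y : S) : setT y -> 0 <= (\1_C y : R)%:E by rewrite lee_fin.
have bC0 (y : S) : setT y -> 0 <= b%:E * (\1_C y : R)%:E by move=> _; exact: mule_ge0.
have vE0 (y : S) : setT y -> 0 <= (v y)%:E by rewrite lee_fin.
have hE0 (y : S) : setT y -> 0 <= (h y)%:E by rewrite lee_fin.
have Pv0 (y : S) : setT y -> 0 <= \int[P y]_z (v z)%:E.
  by move=> _; apply: integral_ge0 => z _; rewrite lee_fin.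
have mbC : measurable_fun setT (fun y => b%:E * (\1_C y : R)%:E).
  exact: measurable_funeM.
rewrite -ge0_integralZl_EFin// -[leLHS]ge0_integralD// -[leRHS]ge0_integralD//.
apply: ge0_le_integral => //.
- by move=> y _; rewrite adde_ge0 ?hE0 ?Pv0.
- exact: emeasurable_funD.
- exact: emeasurable_funD.
move=> y _; have := drift y; rewrite -(leeD2lE (x := (h y)%:E))//.
move=> /le_trans; apply; rewrite -EFinD -EFinM -EFinD lee_fin.
by rewrite addrA subrKC.
Qed.

Lemma drift_sum N x :
  \sum_(0 <= n < N) \int[M n x]_y (h y)%:E + \int[M N x]_y (v y)%:E
  <= (v x)%:E + b%:E * \sum_(0 <= n < N) M n x C.
Proof.
have sum_ge0 k : 0 <= \sum_(0 <= n < k) \int[M n x]_y (h y)%:E.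
  by apply: sume_ge0 => n _; apply: integral_ge0 => y _; rewrite lee_fin.
elim: N => [|N ih].
  rewrite !big_geq// mule0 adde0 add0e (eq_measure_integral \d_x).
    by rewrite integral_dirac// diracT mul1e.
  by move=> A mA _; exact: M0.
rewrite !big_nat_recr//= ge0_muleDr ?sume_ge0// -addeA.
apply: (@le_trans _ _ (\sum_(0 <= n < N) \int[M n x]_y (h y)%:E +
    (\int[M N x]_y (v y)%:E + b%:E * M N x C))); last first.
  by rewrite [leLHS]addeA [leRHS]addeA; exact: (leeD2r _ ih).
rewrite leeD2l//; apply: le_trans (drift_step N x).
by rewrite leeDl// mule_ge0// integral_ge0// => y _; rewrite lee_fin.
Qed.

Lemma drift_sum_le N x :
  \sum_(0 <= n < N) \int[M n x]_y (h y)%:E + \int[M N x]_y (v y)%:E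
  <= (v x + b * c)%:E.
Proof.
apply: (le_trans (drift_sum N x)); rewrite EFinD EFinM leeD2l//.
apply: lee_wpmul2l; first by rewrite lee_fin.
by apply: le_trans (M_C x); exact: nneseries_lim_ge.
Qed.

Lemma drift_bound n x : \int[M n x]_y (v y)%:E <= (v x + b * c)%:E.
Proof.
apply: le_trans (drift_sum_le n x); rewrite leeDr//.
by apply: sume_ge0 => k _; apply: integral_ge0 => y _; rewrite lee_fin.
Qed.

Lemma drift_series x : \sum_(n <oo) \int[M n x]_y (h y)%:E <= (v x + b * c)%:E.
Proof.
apply: lime_le.
  by apply: is_cvg_nneseries => n _ _; apply: integral_ge0 => y _; rewrite lee_fin.
apply: nearW => n; apply: le_trans (drift_sum_le n x); rewrite leeDl//.
by apply: integral_ge0 => y _; rewrite lee_fin.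
Qed.

End drift.

Definition potential (h : S -> \bar R) (x : S) : \bar R :=
  \sum_(n <oo) \int[M n x]_y h y.

Lemma potential1E x : potential (cst 1) x = \sum_(n <oo) M n x setT.
Proof. by apply: eq_eseriesr => n _; rewrite integral_cst// mul1e. Qed.

Lemma integral_M_ge0 n x (h : S -> \bar R) :
  (forall y, 0 <= h y) -> 0 <= \int[M n x]_y h y.
Proof. by move=> h0; exact: integral_ge0. Qed.

Lemma measurable_integral_M n (h : S -> \bar R) :
  measurable_fun setT h -> (forall y, 0 <= h y) ->
  measurable_fun setT (fun x => \int[M n x]_y h y).
Proof.
move=> mh h0; apply: measurable_fun_integral_kernel => // U mU.
exact: measurable_kernel.
Qed.

Lemma measurable_potential (h : S -> \bar R) :
  measurable_fun setT h -> (forall y, 0 <= h y) -> measurable_fun setT (potential h).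
Proof.
move=> mh h0; apply: ge0_emeasurable_sum => [n x _ _|n _].
  exact: integral_M_ge0.
exact: measurable_integral_M.
Qed.

Lemma potential_ge0 (h : S -> \bar R) x : (forall y, 0 <= h y) -> 0 <= potential h x.
Proof. by move=> h0; apply: nneseries_ge0 => n _ _; exact: integral_M_ge0. Qed.

(** The total mass of all [M_n] is both [1 + sum_n M_(n+1)(S)] and [sum_n p_n + sum_n M_(n+1)(S)];
    the common finite part cancels. In probabilistic terms, regeneration occurs almost surely. *)
Lemma sum_p x : potential (cst 1) x < +oo -> \sum_(n <oo) p n x = 1.
Proof.
rewrite potential1E (nneseriesS (fun n => M n x setT))// M0// diracT => fin.
have tfin : \sum_(n <oo) M n.+1 x setT \is a fin_num.
  by rewrite ge0_fin_numE ?nneseries_ge0//; apply: le_lt_trans fin; rewrite leeDr.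
apply/esym/(adde_fin_inj _ _ _ tfin); rewrite -nneseriesD//.
rewrite [LHS]addeC -[X in X + _](diracT R x) -(M0 x setT)//.
rewrite -(nneseriesS (fun n => M n x setT))//.
by apply: eq_eseriesr => n _; exact: M_mass.
Qed.

(** The [p_n] sum to 1 at any starting point, here [point], so one of them is positive; [drift_step]
    bounds [p_n * phi v] for that [n] by a finite quantity. *)
Lemma integral_phi_fin (v h : S -> R) (b : R) : (0 <= b)%R ->
  measurable_fun setT v -> measurable_fun setT h ->
  (forall x, 0 <= v x)%R -> (forall x, 0 <= h x)%R ->
  (forall x, \int[P x]_y (v y)%:E <= (v x - h x + b * \1_C x)%:E) ->
  (forall x, potential (cst 1) x < +oo) -> \int[phi]_y (v y)%:E < +oo.
Proof.
move=> b0 mv mh v0 h0 dr potential1; rewrite ltey; apply/eqP => phiv.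
have : \sum_(n <oo) p n point = 0.
  apply: eseries0 => n _ _; apply/eqP/negPn/negP => pn.
  have : p n point * \int[phi]_y (v y)%:E < +oo.
    apply: (@le_lt_trans _ _ (\int[M n point]_y (v y)%:E + b%:E * M n point C)).
      apply: le_trans (drift_step _ _ _ b0 mv mh v0 h0 dr n point); rewrite leeDr//.
      by rewrite adde_ge0// integral_ge0// => y _; rewrite lee_fin.
    rewrite lte_add_pinfty//.
      exact: le_lt_trans (drift_bound _ _ _ b0 mv mh v0 h0 dr n point) (ltry _).
    apply: (@le_lt_trans _ _ (b%:E * 1)); last by rewrite mule1 ltry.
    apply: lee_wpmul2l; first by rewrite lee_fin.
    by apply: le_trans (sprob_kernel_le1 (M n) point); apply: le_measure; rewrite ?inE.
  by rewrite phiv gt0_muley ?ltxx// lt0e pn p_ge0.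
by rewrite sum_p// => /eqP; rewrite onee_eq0.
Qed.

(** * The occupation measure of a cycle started from [phi] *)

Section stationary.
Hypothesis potential1_fin : forall x, potential (cst 1) x < +oo.
Hypothesis phi_potential1_fin : \int[phi]_x potential (cst 1) x < +oo.

Let kphi : R.-spker unit ~> S := kcst phi (probability_le1 phi measurableT).
Let kM : R.-sfker (unit * S) ~> S := kseries (fun n => kernel.kernel_snd (M n)).
(** This is [phi U]. Obtaining it as a composition of kernels makes it a measure by construction. *)
Definition occupation : {measure set S -> \bar R} := mkcomp kphi kM tt.

Lemma occupationE A : occupation A = \int[phi]_x \sum_(n <oo) M n x A.
Proof. by []. Qed.

Lemma integral_occupation (h : S -> \bar R) :
  measurable_fun setT h -> (forall y, 0 <= h y) ->
  \int[occupation]_y h y = \int[phi]_x potential h x.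
Proof.
move=> mh h0; rewrite (integral_kcomp kphi kM tt)//.
by apply: eq_integral => x _; rewrite integral_kseries.
Qed.

(** One step of [P] turns [sum_n M_n] into [sum_n M_(n+1)] plus the regenerated mass [sum_n p_n = 1]
    distributed as [phi]. Under [phi] that mass replaces the lost term [M_0], since
    [phi M_0 = phi]. *)
Lemma occupation_invariant A : measurable A ->
  \int[occupation]_x P x A = occupation A.
Proof.
move=> mA; have mPA : measurable_fun setT (fun x => P x A) by exact: measurable_kernel.
rewrite integral_occupation// occupationE.
have mMA n : measurable_fun setT (fun x => M n x A) by exact: measurable_kernel.
have mMS : measurable_fun setT (fun x => \sum_(n <oo) M n.+1 x A).
  by apply: ge0_emeasurable_sum.
have M0' x : 0 <= \sum_(n <oo) M n.+1 x A by apply: nneseries_ge0.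
transitivity (\int[phi]_x (\sum_(n <oo) M n.+1 x A + phi A)).
  apply: eq_integral => x _; rewrite /potential.
  transitivity (\sum_(n <oo) (M n.+1 x A + p n x * phi A)).
    by apply: eq_eseriesr => n _; exact: M_step.
  rewrite nneseriesD//; last by move=> i _ _; exact: mule_ge0.
  congr (_ + _); rewrite -[RHS]mul1e -(sum_p x (potential1_fin x)).
  rewrite -(fineK (fin_num_measure phi A mA)) [RHS]muleC -nneseriesZl//.
  by apply: eq_eseriesr => n _; rewrite muleC.
transitivity (\int[phi]_x (\sum_(n <oo) M n.+1 x A + \d_x A)).
  have md : measurable_fun setT (fun x => \d_x A : \bar R).
    by apply/measurable_EFinP; exact: measurable_indic.
  rewrite !ge0_integralD//; congr (_ + _).
  rewrite integral_cst// (_ : _ * _ = phi A); last first.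
    by rewrite -[RHS]mule1; congr (_ * _); exact: probability_setT.
  by rewrite integral_indic// setIT.
by apply: eq_integral => x _; rewrite (nneseriesS (fun n => M n x A))// M0// addeC.
Qed.

Let m := \int[phi]_x potential (cst 1) x.

Lemma mass_ge1 : 1 <= m.
Proof.
have <- : \int[phi]_x cst 1 x = 1.
  by rewrite integral_cst// mul1e; exact: probability_setT.
apply: ge0_le_integral => //; first exact: measurable_potential.
move=> x _; rewrite potential1E (nneseriesS (fun n =>
  M n x setT))// M0// diracT leeDl//.
exact: nneseries_ge0.
Qed.

Lemma integral_stationary (pi : probability S R) (h : S -> \bar R) :
  unique_stationary P pi ->
  measurable_fun setT h -> (forall y, 0 <= h y) ->
  \int[phi]_x potential h x = m * \int[pi]_y h y.
Proof.
move=> [_ piU] mh h0.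
have potentialT : occupation setT = m.
  by rewrite occupationE; apply: eq_integral => x _; rewrite potential1E.
have m_fin : m \is a fin_num by rewrite ge0_fin_numE// (le_trans _ mass_ge1).
have m0 : m != 0 by rewrite gt_eqF// (lt_le_trans _ mass_ge1).
(* The second argument [phi] is the default for mass 0 or infinity, both excluded by [m0] and
   [m_fin]. *)
pose rho := mnormalize occupation phi : probability S R.
have k0 : (0 <= (fine m)^-1)%R by rewrite invr_ge0 fine_ge0// (le_trans _ mass_ge1).
have rhoE A : rho A = mscale (NngNum k0) occupation A.
  rewrite /rho /= /mnormalize potentialT (negbTE m0) -[_ == +oo]negbK -ltey ltey_eq m_fin/=.
  by rewrite muleC.
have irho g : measurable_fun setT g -> (forall y, 0 <= g y) ->
    \int[rho]_y g y = (fine m)^-1%:E * \int[occupation]_y g y.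
  move=> mg g0; rewrite [LHS](eq_measure_integral (mscale (NngNum k0) occupation)).
    by rewrite ge0_integral_mscale.
  by move=> A mA _; exact: rhoE.
have st : stationary P rho.
  move=> A mA; rewrite irho ?occupation_invariant//; last exact: measurable_kernel.
have -> : \int[pi]_y h y = \int[rho]_y h y.
  by apply: eq_measure_integral => A mA _; apply/esym; exact: piU.
rewrite (irho h mh h0) (integral_occupation h mh h0).
move: (\int[phi]_x potential h x) => I; clear - m_fin m0.
move: m m_fin m0 => [a| |]// _ a0 /=.
by rewrite muleA -EFinM divff// mul1e.
Qed.

End stationary.

(** * Discounted potentials *)

Definition dpotential (r : R) (h : S -> \bar R) (x : S) : \bar R :=
  \sum_(n <oo) (r ^+ n)%:E * \int[M n x]_y h y.

Section discounted_occupation.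
Variables (r : R) (h : S -> \bar R).
Hypothesis r01 : (0 <= r <= 1)%R.
Hypothesis h0 : forall y, 0 <= h y.

Let rM0 n x : 0 <= (r ^+ n)%:E * \int[M n x]_y h y.
Proof.
by case/andP: r01 => r0 _; rewrite mule_ge0 ?lee_fin ?exprn_ge0 ?integral_ge0.
Qed.

Lemma dpotential_ge0 x : 0 <= dpotential r h x.
Proof. by apply: nneseries_ge0 => n _ _; exact: rM0. Qed.

Lemma dpotential_le x : dpotential r h x <= potential h x.
Proof.
apply: lee_nneseries => [n _ _|n _]; first exact: rM0.
case/andP: r01 => r0 r1; rewrite -[leRHS]mul1e; apply: lee_wpmul2r.
  exact: integral_ge0.
by rewrite lee_fin exprn_ile1.
Qed.

Lemma measurable_dpotential : measurable_fun setT h ->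
  measurable_fun setT (dpotential r h).
Proof.
move=> mh; apply: ge0_emeasurable_sum => [n x _ _|n _]; first exact: rM0.
by apply: measurable_funeM; exact: measurable_integral_M.
Qed.

End discounted_occupation.

Lemma dpotential_nd (r s : R) (h : S -> \bar R) x : (0 <= r)%R -> (r <= s)%R ->
  (forall y, 0 <= h y) -> dpotential r h x <= dpotential s h x.
Proof.
move=> r0 rs h0; apply: lee_nneseries => [n _ _|n _].
  by rewrite mule_ge0 ?lee_fin ?exprn_ge0 ?integral_ge0.
apply: lee_wpmul2r; first exact: integral_ge0.
by rewrite lee_fin lerXn2r ?nnegrE// (le_trans r0).
Qed.

Let disc01 k : (0 <= @discount R k <= 1)%R.
Proof. by have /andP[? ?] := @discount_itv R k; rewrite !ltW. Qed.

Lemma dpotential_cvg (h : S -> \bar R) x : (forall y, 0 <= h y) ->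
  potential h x < +oo ->
  dpotential (discount k) h x @[k --> \oo] --> potential h x.
Proof.
move=> h0 fin; apply: abel_cvg => [k|||n|n].
- by have /andP[] := disc01 k.
- exact: discount_nd.
- exact: discount_cvg.
- exact: integral_ge0.
- apply: (nneseries_term_fin (fun n => \int[M n x]_y h y)) => // k.
  exact: integral_ge0.
Qed.

Lemma phi_dpotential_cvg (h : S -> \bar R) :
  measurable_fun setT h -> (forall y, 0 <= h y) -> (forall x, potential h x < +oo) ->
  \int[phi]_x dpotential (discount k) h x @[k --> \oo] --> \int[phi]_x potential h x.
Proof.
move=> mh h0 fin.
have -> : \int[phi]_x potential h x = \int[phi]_x limn (fun k =>
  dpotential (discount k) h x).
  by apply: eq_integral => x _; apply/esym/cvg_lim => //; exact: dpotential_cvg.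
apply: cvg_monotone_convergence => //.
- by move=> k; apply: measurable_dpotential.
- by move=> k x _; apply: dpotential_ge0.
- move=> x _ i j ij; apply: dpotential_nd => //; last exact: discount_nd.
  by have /andP[] := disc01 i.
Qed.

(* Stated without subtractions, so that both sides can be integrated. *)
Lemma resolvent_dpotential (r k : R) (v f w : S -> R) (b : R) :
  (0 < r < 1)%R -> (0 <= b)%R ->
  measurable_fun setT v -> measurable_fun setT f -> measurable_fun setT w ->
  (forall x, 0 <= v x)%R -> (forall x, 0 <= f x)%R -> (forall x, 0 <= w x)%R ->
  (forall x, \int[P x]_y (v y)%:E <= (v x - f x + b * \1_C x)%:E) ->
  (forall x, w x <= r^-1 * v x + k)%R ->
  (forall x, (w x)%:E = (f x)%:E + r%:E * \int[P x]_y (w y)%:E) ->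
  (forall x, potential (EFin \o f) x < +oo) -> (forall x, potential (cst 1) x < +oo) ->
  \int[phi]_y (w y)%:E < +oo ->
  forall x, dpotential r (EFin \o f) x + \int[phi]_y (w y)%:E =
    (w x)%:E + ((1 - r)%:E * \int[phi]_y (w y)%:E) * dpotential r (cst 1) x.
Proof.
move=> r01 b0 mv mf mw v0 f0 w0 dr wv wE potentialf potential1 phiw x.
have /andP[r0 r1] := r01.
have r01' : (0 <= r <= 1)%R by rewrite !ltW.
have wE0 y : 0 <= (w y)%:E by rewrite lee_fin.
have fE0 y : 0 <= (f y)%:E by rewrite lee_fin.
have vE0 y : 0 <= (v y)%:E by rewrite lee_fin.
have mwE : measurable_fun setT (EFin \o w) by exact/measurable_EFinP.
have mfE : measurable_fun setT (EFin \o f) by exact/measurable_EFinP.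
have mvE : measurable_fun setT (EFin \o v) by exact/measurable_EFinP.
have phiw_fin : \int[phi]_y (w y)%:E \is a fin_num.
  by rewrite ge0_fin_numE// integral_ge0.
set Phi := fine (\int[phi]_y (w y)%:E).
(* Uniform in [n]: the bound on [w] integrated with [drift_bound]. The absolute value is there
   because [k] has no prescribed sign. *)
pose K := (r^-1 * (v x + b * c) + `|k|)%R.
have MwK n : \int[M n x]_y (w y)%:E <= K%:E.
  have ri0 : (0 <= r^-1)%R by rewrite invr_ge0 ltW.
  apply: (@le_trans _ _ (\int[M n x]_y (r^-1%:E * (v y)%:E + `|k|%:E))).
    apply: ge0_le_integral => //.
    - by apply: emeasurable_funD => //; exact: measurable_funeM.
    - move=> y _; rewrite -EFinM -EFinD lee_fin (le_trans (wv y))// lerD2l.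
      exact: ler_norm.
  have rv0 (y : S) : setT y -> 0 <= r^-1%:E * (v y)%:E.
    by move=> _; rewrite mule_ge0 ?lee_fin.
  have mrv : measurable_fun setT (fun y => r^-1%:E * (v y)%:E).
    exact: measurable_funeM.
  have k0 (y : S) : setT y -> 0 <= `|k|%:E by rewrite lee_fin.
  rewrite ge0_integralD// ge0_integralZl_EFin// integral_cst// /K EFinD EFinM.
  apply: leeD.
    by apply: lee_wpmul2l;
      [rewrite lee_fin|exact: (drift_bound _ _ _ b0 mv mf v0 f0 dr)].
  by rewrite -[leRHS]mule1; apply: lee_wpmul2l; rewrite ?lee_fin// sprob_kernel_le1.
have Mw_fin n : \int[M n x]_y (w y)%:E \is a fin_num.
  by rewrite ge0_fin_numE ?integral_ge0//; exact: le_lt_trans (MwK n) (ltry _).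
have Mf_fin n : \int[M n x]_y (f y)%:E \is a fin_num.
  apply: (nneseries_term_fin (fun n => \int[M n x]_y (f y)%:E)) => [j|].
    exact: integral_ge0.
  exact: potentialf.
have M1_fin n : M n x setT \is a fin_num.
  by rewrite ge0_fin_numE//; exact: le_lt_trans (sprob_kernel_le1 (M n) x) (ltry _).
pose W n := fine (\int[M n x]_y (w y)%:E).
pose F n := fine (\int[M n x]_y (f y)%:E).
pose T n := fine (M n x setT).
have TE n : (T n = T n.+1 + fine (p n x))%R.
  by rewrite /T M_mass fineD// p_fin.
have WE n : (W n = F n + r * (W n.+1 + fine (p n x) * Phi))%R.
  have mPw : measurable_fun setT (fun y => \int[P y]_z (w z)%:E).
    apply: measurable_fun_integral_kernel => // U mU; exact: measurable_kernel.
  have Pw0 (y : S) : setT y -> 0 <= \int[P y]_z (w z)%:E.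
    by move=> _; exact: integral_ge0.
  have rPw0 (y : S) : setT y -> 0 <= r%:E * \int[P y]_z (w z)%:E.
    by move=> /Pw0; apply: mule_ge0; rewrite lee_fin ltW.
  have mrPw : measurable_fun setT (fun y => r%:E * \int[P y]_z (w z)%:E).
    exact: measurable_funeM.
  have E1 : \int[M n x]_y (r%:E * \int[P y]_z (w z)%:E) =
      r%:E * \int[M n x]_y \int[P y]_z (w z)%:E.
    by rewrite ge0_integralZl_EFin// ltW.
  apply: EFin_inj; rewrite EFinD EFinM EFinD EFinM !fineK// ?p_fin//.
  rewrite -(integral_M_step n x _ mwE wE0) -E1.
  have E2 : \int[M n x]_y ((f y)%:E + r%:E * \int[P y]_z (w z)%:E) =
      \int[M n x]_y (f y)%:E + \int[M n x]_y (r%:E * \int[P y]_z (w z)%:E).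
    by rewrite ge0_integralD.
  by rewrite -E2; apply: eq_integral => y _; exact: wE.
(* [Z n] is [M_n (w - phi w)]. Centring by [Phi] makes the regeneration term [p_n * Phi] in [WE]
   cancel against the loss of mass in [TE]. *)
pose Z n := (W n - Phi * T n)%R.
pose a n := (F n - (1 - r) * Phi * T n)%R.
have ZE n : (Z n = a n + r * Z n.+1)%R.
  by rewrite /Z /a WE (TE n); ring.
have Phi0 : (0 <= Phi)%R by rewrite fine_ge0// integral_ge0.
have T01 n : (0 <= T n <= 1)%R.
  by rewrite fine_ge0//= -lee_fin fineK//; exact: sprob_kernel_le1.
have W0K n : (0 <= W n <= K)%R.
  by rewrite fine_ge0 ?integral_ge0//= -lee_fin fineK.
have ZK n : (`|Z n| <= K + Phi)%R.
  have /andP[T0 T1] := T01 n; have /andP[W0 WK] := W0K n.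
  have /andP[PT0 PT1] : (0 <= Phi * T n <= Phi)%R by rewrite mulr_ge0//= ler_piMr.
  by rewrite ler_norml /Z; apply/andP; split; lra.
have r01'' : (0 <= r < 1)%R by rewrite ltW.
have cZ := discounted_telescope r (K + Phi) Z a r01'' ZE ZK.
have dpotentialf : dpotential r (EFin \o f) x < +oo
  by exact: le_lt_trans (dpotential_le _ _ r01' fE0 x) (potentialf x).
have dpotential1 : dpotential r (cst 1) x < +oo.
  by apply: le_lt_trans (potential1 x); apply: dpotential_le => // y; rewrite lee_fin.
have rpow0 n : 0 <= (r ^+ n)%:E by rewrite lee_fin exprn_ge0// ltW.
have cF := nneseries_fine_cvg (fun n => (r ^+ n)%:E * \int[M n x]_y (f y)%:E).
have cT := nneseries_fine_cvg (fun n => (r ^+ n)%:E * \int[M n x]_y (cst 1) y).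
have {}cF := cF (fun k => mule_ge0 (rpow0 k) (integral_M_ge0 k x _ fE0)) dpotentialf.
have c10 (y : S) : 0 <= cst 1 y :> \bar R by rewrite lee_fin.
have {}cT := cT (fun k => mule_ge0 (rpow0 k) (integral_M_ge0 k x _ c10)) dpotential1.
(* The same partial sums, split into the two discounted potentials; comparing limits gives the
   identity in real numbers. *)
have cZ' : (\sum_(0 <= k < n) r ^+ k * a k)%R @[n --> \oo] -->
    (fine (dpotential r (EFin \o f) x) - (1 - r) * Phi * fine (dpotential r (cst 1)%E x))%R.
  have E n : (\sum_(0 <= k < n) r ^+ k * a k =
      \sum_(0 <= k < n) fine ((r ^+ k)%:E * \int[M k x]_y (f y)%:E) -
      (1 - r) * Phi * \sum_(0 <= k < n) fine ((r ^+ k)%:E * \int[M k x]_y (cst 1 y)%E))%R.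
    rewrite mulr_sumr -sumrB; apply: eq_bigr => j _.
    rewrite fineM// fineM//; last by rewrite integral_cst// mul1e.
    by rewrite integral_cst// mul1e /a /F /T /=; ring.
  under eq_fun do rewrite E.
  by apply: cvgB => //; apply: cvgMr.
have ZZ : (w x - Phi = fine (dpotential r (EFin \o f) x) -
    (1 - r) * Phi * fine (dpotential r (cst 1)%E x))%R.
  rewrite -[LHS](_ : Z 0%N = _); first exact: (cvg_unique _ cZ cZ').
  rewrite /Z /T M0// diracT mulr1 /W (eq_measure_integral \d_x).
    by rewrite integral_dirac// diracT mul1e.
  by move=> A mA _; exact: M0.
have F1 : dpotential r (EFin \o f) x \is a fin_num by rewrite ge0_fin_numE ?dpotential_ge0.
have F2 : dpotential r (cst 1) x \is a fin_num by rewrite ge0_fin_numE ?dpotential_ge0.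
have PhiE : \int[phi]_y (w y)%:E = Phi%:E by rewrite fineK.
rewrite PhiE; move: (dpotential r (EFin \o f) x) (dpotential r (cst 1) x) F1 F2 ZZ.
move=> [A| |]// [B| |]// _ _ /= ZZ.
by rewrite -!EFinM -!EFinD; congr EFin; lra.
Qed.

(** * The limit of vanishing discount *)

Section poisson.
Variables (f v1 v2 : S -> R) (b1 b2 : R) (pi : probability S R).
Hypotheses (b10 : (0 <= b1)%R) (b20 : (0 <= b2)%R).
Hypotheses (mf : measurable_fun setT f) (mv1 : measurable_fun setT v1)
  (mv2 : measurable_fun setT v2).
Hypotheses (f0 : forall x, (0 <= f x)%R) (v10 : forall x, (0 <= v1 x)%R)
  (v20 : forall x, (0 <= v2 x)%R).
Hypothesis drift1 : forall x,
  \int[P x]_y (v1 y)%:E <= (v1 x - f x + b1 * \1_C x)%:E.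
Hypothesis drift2 : forall x,
  \int[P x]_y (v2 y)%:E <= (v2 x - 1 + b2 * \1_C x)%:E.
Hypothesis hpi : unique_stationary P pi.

Let mfE : measurable_fun setT (EFin \o f). Proof. exact/measurable_EFinP. Qed.
Let fE0 y : 0 <= (f y)%:E. Proof. by rewrite lee_fin. Qed.
Let c10 (y : S) : 0 <= (cst 1 y : \bar R). Proof. by rewrite lee_fin. Qed.
Let mc1 : measurable_fun setT (cst 1 : S -> \bar R). Proof. by []. Qed.

Lemma potential_f_le x : potential (EFin \o f) x <= (v1 x + b1 * c)%:E.
Proof. exact: (drift_series _ _ _ b10 mv1 mf v10 f0 drift1). Qed.

Lemma potential_1_le x : potential (cst 1) x <= (v2 x + b2 * c)%:E.
Proof.
apply: (drift_series _ (fun=> 1%R) _ b20 mv2 _ v20 _ drift2 x) => //.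
Qed.

Lemma potential_f_fin x : potential (EFin \o f) x < +oo.
Proof. exact: le_lt_trans (potential_f_le x) (ltry _). Qed.

Lemma potential_1_fin x : potential (cst 1) x < +oo.
Proof. exact: le_lt_trans (potential_1_le x) (ltry _). Qed.

Let phiv1 : \int[phi]_x (v1 x)%:E < +oo.
Proof. exact: (integral_phi_fin _ _ _ b10 mv1 mf v10 f0 drift1 potential_1_fin). Qed.

Let phiv2 : \int[phi]_x (v2 x)%:E < +oo.
Proof. by apply: (integral_phi_fin _ (fun=> 1%R) _ b20 mv2 _ v20 _ drift2 potential_1_fin). Qed.

Let phi_le_fin (h : S -> \bar R) (v : S -> R) (k s : R) :
  measurable_fun setT h -> (forall x, 0 <= h x) -> (0 <= s)%R ->
  measurable_fun setT v -> (forall x, 0 <= v x)%R ->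
  \int[phi]_x (v x)%:E < +oo -> (forall x, h x <= (s * v x + k)%:E) ->
  \int[phi]_x h x < +oo.
Proof.
move=> mh h0 s0 mv v0 phiv hv.
have mvE : measurable_fun setT (EFin \o v) by exact/measurable_EFinP.
have sv0 (x : S) : setT x -> 0 <= s%:E * (v x)%:E.
  by move=> _; rewrite mule_ge0 ?lee_fin.
have vE0 (x : S) : setT x -> 0 <= (v x)%:E by rewrite lee_fin.
have k0 (x : S) : setT x -> 0 <= `|k|%:E by rewrite lee_fin.
have msv : measurable_fun setT (fun x => s%:E * (v x)%:E) by exact: measurable_funeM.
apply: (@le_lt_trans _ _ (\int[phi]_x (s%:E * (v x)%:E + `|k|%:E))).
  apply: ge0_le_integral => //; first exact: emeasurable_funD.
  move=> x _; apply: (le_trans (hv x)); rewrite EFinD EFinM leeD2l// lee_fin.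
  exact: ler_norm.
rewrite ge0_integralD// ge0_integralZl_EFin// integral_cst//.
apply: lte_add_pinfty; first exact: lte_mul_pinfty.
apply: (@le_lt_trans _ _ (`|k|%:E * 1)); last by rewrite mule1 ltry.
by apply: lee_wpmul2l; [rewrite lee_fin|exact: (probability_le1 phi measurableT)].
Qed.

Let m := \int[phi]_x potential (cst 1) x.

Let m_lty : m < +oo.
Proof.
apply: (phi_le_fin _ v2 (b2 * c) 1) => //.
- exact: measurable_potential.
- by move=> x; exact: potential_ge0.
- by move=> x; rewrite mul1r; exact: potential_1_le.
Qed.

Let m_ge1 : 1 <= m. Proof. by apply: mass_ge1 => //; exact: potential_1_fin. Qed.

Let m_fin : m \is a fin_num.
Proof. by rewrite ge0_fin_numE// (le_trans _ m_ge1). Qed.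

Let potential_pi : \int[phi]_x potential (EFin \o f) x = m * \int[pi]_x (f x)%:E.
Proof. by apply: integral_stationary => //; exact: potential_1_fin. Qed.

(** By [potential_pi], [m * pi f] equals [phi U f], which is at most [phi v1] plus a constant;
    moreover [m >= 1]. *)
Lemma integral_pi_fin : \int[pi]_x (f x)%:E \is a fin_num.
Proof.
have pif0 : 0 <= \int[pi]_x (f x)%:E by exact: integral_ge0.
rewrite ge0_fin_numE//.
apply: (@le_lt_trans _ _ (m * \int[pi]_x (f x)%:E)).
  by rewrite -[leLHS]mul1e; exact: lee_wpmul2r.
rewrite -potential_pi; apply: (phi_le_fin _ v1 (b1 * c) 1) => //.
- exact: measurable_potential.
- by move=> x; exact: potential_ge0.
- by move=> x; rewrite mul1r; exact: potential_f_le.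
Qed.

Let pif := fine (\int[pi]_x (f x)%:E).

Let w_ex k : exists w : S -> R, [/\ measurable_fun setT w, forall x, (0 <= w x)%R,
    forall x, (w x <= (discount k)^-1 * v1 x + b1 / (1 - discount k))%R &
    forall x, (w x)%:E = (f x)%:E + (discount k)%:E * \int[P x]_y (w y)%:E].
Proof. by apply: resolvent drift1 => //; exact: discount_itv. Qed.

Let w k := sval (cid (w_ex k)).
Let mw k : measurable_fun setT (w k). Proof. by rewrite /w; case: cid => ? []. Qed.
Let w0 k x : (0 <= w k x)%R. Proof. by rewrite /w; case: cid => ? []. Qed.
Let w_le k x : (w k x <= (discount k)^-1 * v1 x + b1 / (1 - discount k))%R.
Proof. by rewrite /w; case: cid => ? []. Qed.
Let wE k x : (w k x)%:E = (f x)%:E + (discount k)%:E * \int[P x]_y (w k y)%:E.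
Proof. by rewrite /w; case: cid => ? []. Qed.
Let mwE k : measurable_fun setT (EFin \o w k).
Proof. by apply/measurable_EFinP. Qed.
Let wE0 k y : 0 <= (w k y)%:E. Proof. by rewrite lee_fin. Qed.

Let r0 k : (0 < @discount R k)%R. Proof. by have /andP[] := @discount_itv R k. Qed.
Let r1 k : (@discount R k < 1)%R. Proof. by have /andP[] := @discount_itv R k. Qed.

Let phiw k : \int[phi]_x (w k x)%:E < +oo.
Proof.
have ri0 : (0 <= (@discount R k)^-1)%R by rewrite invr_ge0 ltW.
exact: (phi_le_fin _ v1 _ _ (mwE k) (wE0 k) ri0 mv1 v10 phiv1 (w_le k)).
Qed.

Let Phi k := fine (\int[phi]_x (w k x)%:E).
Let PhiE k : \int[phi]_x (w k x)%:E = (Phi k)%:E.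
Proof. by rewrite fineK// ge0_fin_numE ?integral_ge0. Qed.
Let Phi0 k : (0 <= Phi k)%R.
Proof. by rewrite -lee_fin -PhiE integral_ge0. Qed.

Let beta k := ((1 - discount k) * Phi k)%R.
Let beta0 k : (0 <= beta k)%R.
Proof. by rewrite mulr_ge0// subr_ge0 ltW. Qed.

Let dpotentialE k x : dpotential (discount k) (EFin \o f) x + (Phi k)%:E =
  (w k x)%:E + (beta k)%:E * dpotential (discount k) (cst 1) x.
Proof.
have := resolvent_dpotential (discount k) _ v1 f (w k) b1 (discount_itv k) b10 mv1 mf
  (mw k) v10 f0 (w0 k) drift1 (w_le k) (wE k) potential_f_fin potential_1_fin (phiw k) x.
by rewrite PhiE -EFinM.
Qed.

Let dpotential_fin k (h : S -> \bar R) x : (forall y, 0 <= h y) ->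
  potential h x < +oo ->
  dpotential (discount k) h x \is a fin_num.
Proof.
move=> h0 fin; rewrite ge0_fin_numE; last exact: (dpotential_ge0 _ _ (disc01 k)).
exact: le_lt_trans (dpotential_le _ _ (disc01 k) h0 x) fin.
Qed.

(** Integrating [dpotentialE] against [phi] puts the finite number [Phi k] on both sides, where it
    cancels. Thus [beta k] is a ratio of discounted occupations. *)
Let phi_dpotential k : \int[phi]_x dpotential (discount k) (EFin \o f) x =
  (beta k)%:E * \int[phi]_x dpotential (discount k) (cst 1) x.
Proof.
have mdf : measurable_fun setT (dpotential (discount k) (EFin \o f))
  by exact: (measurable_dpotential _ _ (disc01 k)).
have md1 : measurable_fun setT (dpotential (discount k) (cst 1))
  by exact: (measurable_dpotential _ _ (disc01 k)).
have df0 x : 0 <= dpotential (discount k) (EFin \o f) x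
  by exact: (dpotential_ge0 _ _ (disc01 k)).
have d10 x : 0 <= dpotential (discount k) (cst 1) x
  by exact: (dpotential_ge0 _ _ (disc01 k)).
have bd0 x : 0 <= (beta k)%:E * dpotential (discount k) (cst 1) x
  by rewrite mule_ge0 ?lee_fin.
have mbd : measurable_fun setT (fun x =>
  (beta k)%:E * dpotential (discount k) (cst 1) x).
  exact: measurable_funeM.
have : \int[phi]_x (dpotential (discount k) (EFin \o f) x + (Phi k)%:E) =
    \int[phi]_x ((w k x)%:E + (beta k)%:E * dpotential (discount k) (cst 1) x).
  by apply: eq_integral => x _; exact: dpotentialE.
have -> : \int[phi]_x (dpotential (discount k) (EFin \o f) x + (Phi k)%:E) =
    \int[phi]_x dpotential (discount k) (EFin \o f) x + \int[phi]_x (Phi k)%:E.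
  by rewrite ge0_integralD// => x _; rewrite lee_fin.
have -> : \int[phi]_x ((w k x)%:E + (beta k)%:E * dpotential (discount k) (cst 1) x) =
    (Phi k)%:E + (beta k)%:E * \int[phi]_x dpotential (discount k) (cst 1) x.
  transitivity (\int[phi]_x (w k x)%:E +
      \int[phi]_x ((beta k)%:E * dpotential (discount k) (cst 1) x)).
    exact: (ge0_integralD phi measurableT (fun x _ => wE0 k x) (mwE k)
      (fun x _ => bd0 x) mbd).
  rewrite PhiE; congr (_ + _); apply: ge0_integralZl_EFin => //.
rewrite integral_cst//.
rewrite (_ : (Phi k)%:E * _ = (Phi k)%:E); last first.
  by rewrite -[RHS]mule1; congr (_ * _); exact: probability_setT.
by rewrite addeC => /adde_fin_inj; apply.
Qed.

(** The term [n = 0] alone contributes 1, so the denominator of the ratio defining [beta k] never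
    vanishes. *)
Let phi_dpotential1_ge1 k : 1 <= \int[phi]_x dpotential (discount k) (cst 1) x.
Proof.
have phi1 : \int[phi]_x cst 1 x = 1.
  by rewrite integral_cst// mul1e; exact: probability_setT.
rewrite -[leLHS]phi1.
have md1 : measurable_fun setT (dpotential (discount k) (cst 1)).
  exact: (measurable_dpotential _ _ (disc01 k)).
apply: ge0_le_integral; [by []|by move=> x _; exact: c10|exact: mc1|exact: md1|].
move=> x _; apply: (@le_trans _ _ ((discount k ^+ 0)%:E * \int[M 0 x]_y cst 1 y)).
  by rewrite expr0 mul1e integral_cst// mul1e M0// diracT.
apply: (nneseries_term_le (fun n => (discount k ^+ n)%:E * \int[M n x]_y cst 1 y)) => n.
by rewrite mule_ge0 ?integral_ge0// lee_fin exprn_ge0// ltW.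
Qed.

(** Numerator and denominator increase to [phi U f = m * pi f] and [phi U 1 = m]. *)
Let beta_cvg : beta k @[k --> \oo] --> pif.
Proof.
have c1 : \int[phi]_x dpotential (discount k) (cst 1) x @[k --> \oo] --> (fine m)%:E.
  by rewrite fineK//; apply: phi_dpotential_cvg => // x; exact: potential_1_fin.
have cf : \int[phi]_x dpotential (discount k) (EFin \o f) x @[k --> \oo] --> (fine m * pif)%:E.
  rewrite EFinM !fineK ?integral_pi_fin// -potential_pi.
  by apply: phi_dpotential_cvg => // x; exact: potential_f_fin.
have fm0 : fine m != 0%R.
  by rewrite gt_eqF// fine_gt0// (lt_le_trans _ m_ge1)//= m_lty.
have bE k : beta k = (fine (\int[phi]_x dpotential (discount k) (EFin \o f) x) /
    fine (\int[phi]_x dpotential (discount k) (cst 1)%E x))%R.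
  have d1fin : \int[phi]_x dpotential (discount k) (cst 1) x \is a fin_num.
    rewrite ge0_fin_numE ?(le_trans _ (phi_dpotential1_ge1 k))//.
    apply: le_lt_trans m_lty; apply: ge0_le_integral => //.
    - by move=> x _; exact: (dpotential_ge0 _ _ (disc01 k)).
    - exact: (measurable_dpotential _ _ (disc01 k)).
    - exact: measurable_potential.
    - by move=> x _; exact: (dpotential_le _ _ (disc01 k)).
  rewrite phi_dpotential fineM//= mulfK// gt_eqF// fine_gt0//.
  by rewrite (lt_le_trans _ (phi_dpotential1_ge1 k))//=; move: d1fin;
    rewrite fin_numE ltey => /andP[].
have -> : beta = fun k => (fine (\int[phi]_x dpotential (discount k) (EFin \o f) x) /
    fine (\int[phi]_x dpotential (discount k) (cst 1)%E x))%R by apply/funext.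
have -> : pif = (fine m * pif / fine m)%R by rewrite mulrAC divff// mul1r.
exact: (cvgM (fine_cvg cf) (cvgV fm0 (fine_cvg c1))).
Qed.

Let g k x := (w k x - Phi k)%R.

Let gE k x : (g k x)%:E = dpotential (discount k) (EFin \o f) x -
  (beta k)%:E * dpotential (discount k) (cst 1) x.
Proof.
have F1 := dpotential_fin k _ x fE0 (potential_f_fin x).
have F2 := dpotential_fin k _ x c10 (potential_1_fin x).
have := dpotentialE k x; move: (dpotential _ _ _) (dpotential _ (cst 1) x) F1 F2.
move=> [a| |]// [e| |]// _ _; rewrite /g -EFinM -!EFinD => -[E].
by congr EFin; lra.
Qed.

Let integrable_P_cst x (a : R) : (P x).-integrable setT (EFin \o cst a).
Proof.
apply/integrableP; split; first by apply/measurable_EFinP.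
rewrite /= integral_cst//; apply: (@le_lt_trans _ _ (`|a|%:E * 1)).
  by apply: lee_wpmul2l; [rewrite lee_fin|exact: sprob_kernel_le1].
by rewrite mule1 ltry.
Qed.

(** The discounted Poisson equation: replacing [w] by [w - Phi] in [w = f + r P w] costs the
    constant [(1 - r) * Phi = beta], because [P] preserves constants. *)
Let g_rec k x : (g k x)%:E = (f x - beta k)%:E +
  (discount k)%:E * \int[P x]_y (g k y)%:E.
Proof.
have Pw0 : 0 <= \int[P x]_y (w k y)%:E by exact: integral_ge0.
(* An infinite value would make [w k x] infinite, the discount being positive. *)
have Pw : \int[P x]_y (w k y)%:E \is a fin_num.
  have := wE k x; case: (\int[P x]_y (w k y)%:E) Pw0 => //.
  by rewrite gt0_muley ?lte_fin// addey.
have iw : (P x).-integrable setT (EFin \o w k).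
  apply/integrableP; split => //.
  have -> : \int[P x]_y `|(EFin \o w k) y| = \int[P x]_y (w k y)%:E.
    by apply: eq_integral => y _; rewrite gee0_abs//= lee_fin.
  by rewrite -ge0_fin_numE.
have Pg : \int[P x]_y (g k y)%:E = \int[P x]_y (w k y)%:E - (Phi k)%:E.
  rewrite integralB_EFin//; last exact: integrable_P_cst.
  rewrite integral_cst//; congr (_ - _).
  by rewrite -[RHS]mule1; congr (_ * _); exact: prob_kernel.
rewrite Pg; have := wE k x; move: (\int[P x]_y (w k y)%:E) Pw => [a| |]// _.
rewrite -EFinB -!EFinM -!EFinD => -[E]; congr EFin.
by rewrite /g /beta E; ring.
Qed.

(** A difference of two finite potentials, so that only nonnegative functions are integrated against
    the [M_n]. *)
Definition poisson_sol x : \bar R :=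
  potential (EFin \o f) x - \int[pi]_y (f y)%:E * potential (cst 1) x.

Let g_cvg x : (g k x)%:E @[k --> \oo] --> poisson_sol x.
Proof.
under eq_fun do rewrite gE.
have o1 : potential (cst 1) x \is a fin_num
  by rewrite ge0_fin_numE ?potential_ge0// potential_1_fin.
have of_ : potential (EFin \o f) x \is a fin_num
  by rewrite ge0_fin_numE ?potential_ge0// potential_f_fin.
apply: cvgeB.
- by apply: fin_num_adde_defr.
- by apply: dpotential_cvg => //; exact: potential_f_fin.
apply: cvgeM.
- by apply: mule_def_fin => //; exact: integral_pi_fin.
- rewrite -(fineK integral_pi_fin); apply: cvg_EFin; [exact: nearW|exact: beta_cvg].
- by apply: dpotential_cvg => //; exact: potential_1_fin.
Qed.

Theorem killed_chain_poisson :
  poisson_solution P (fun x => (f x)%:E - \int[pi]_y (f y)%:E) poisson_sol.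
Proof.
move=> x.
(* A bound on all [beta k], needed for a dominating function independent of [k]. *)
have [B betaB] : exists B, forall k, (beta k <= B)%R.
  have [B [_ betaB]] := cvg_seq_bounded (cvgP _ beta_cvg).
  exists (B + 1)%R => k; apply: le_trans (ler_norm _) _.
  by apply: betaB => //; rewrite ltrDl.
have B0 : (0 <= B)%R := le_trans (beta0 0) (betaB 0%N).
have pif0 : (0 <= pif)%R by rewrite fine_ge0 ?integral_ge0.
(* Dominates [U f - s U 1] and its discounted versions in absolute value for [s >= 0]. It serves
   with [s = pif] for the limit and with [s = B] for every [g k]; it is [P x]-integrable since the
   drift conditions make [P v1] and [P v2] finite at [x]. *)
pose G s y := (v1 y + b1 * c + s * (v2 y + b2 * c))%R.
have G1 y : (0 <= v1 y + b1 * c)%R.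
  by rewrite -lee_fin; exact: le_trans (potential_ge0 _ y fE0) (potential_f_le y).
have G2 y : (0 <= v2 y + b2 * c)%R.
  by rewrite -lee_fin; exact: le_trans (potential_ge0 _ y c10) (potential_1_le y).
have iv (v h : S -> R) (b : R) : measurable_fun setT v -> (forall y, 0 <= v y)%R ->
    \int[P x]_y (v y)%:E <= (v x - h x + b * \1_C x)%:E ->
    (P x).-integrable setT (EFin \o v).
  move=> mv v0 dr; apply/integrableP; split; first exact/measurable_EFinP.
  apply: le_lt_trans (ltry _); apply: le_trans dr; rewrite le_eqVlt; apply/orP; left.
  by apply/eqP/eq_integral => y _; rewrite gee0_abs//= lee_fin.
have iG s : (P x).-integrable setT (EFin \o G s).
  have i1 := iv _ _ _ mv1 v10 (drift1 x).
  have i2 := iv _ (fun=> 1%R) _ mv2 v20 (drift2 x).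
  have i3 := integrableD measurableT i1 (integrableD measurableT
    (integrableZl measurableT s i2) (integrable_P_cst x (b1 * c + s * (b2 * c)))).
  apply: eq_integrable i3 => // y _ /=.
  by congr EFin; rewrite /G; ring.
have bound s y (a1 a2 : \bar R) : (0 <= s)%R -> 0 <= a1 -> 0 <= a2 ->
    a1 <= potential (EFin \o f) y -> a2 <= potential (cst 1) y ->
      `|a1 - s%:E * a2| <= (G s y)%:E.
  move=> s0 + + /le_trans/(_ (potential_f_le y)) + /le_trans/(_ (potential_1_le y)).
  case: a1 => [a1| |]//; case: a2 => [a2| |]//; rewrite !lee_fin => p1 p2 l1 l2.
  have p3 : (0 <= s * a2)%R by rewrite mulr_ge0.
  have p4 : (s * a2 <= s * (v2 y + b2 * c))%R by rewrite ler_wpM2l.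
  change (`|a1 - s * a2| <= G s y)%R.
  by rewrite /G ler_norml; apply/andP; split; lra.
have msol : measurable_fun setT poisson_sol.
  apply: emeasurable_funB; first exact: measurable_potential.
  by apply: measurable_funeM; exact: measurable_potential.
have isol : (P x).-integrable setT poisson_sol.
  apply: le_integrable (iG pif) => // y _ /=.
  rewrite ger0_norm; last by rewrite addr_ge0// mulr_ge0.
  rewrite /poisson_sol -(fineK integral_pi_fin); apply: bound => //;
    exact: potential_ge0.
split=> //.
have cg : \int[P x]_y (g k y)%:E @[k --> \oo] --> \int[P x]_y poisson_sol y.
  apply: (dominated_cvg measurableT (g := EFin \o G B)).
  - by move=> k; apply/measurable_EFinP; exact: measurable_funB.
  - by move=> y _; exact: g_cvg.
  - by [].
  - exact: iG.
  - move=> k y _; rewrite gE; apply: le_trans (bound (beta k) y _ _ _ _ _ _ _) _ => //.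
    + exact: (dpotential_ge0 _ _ (disc01 k)).
    + exact: (dpotential_ge0 _ _ (disc01 k)).
    + exact: (dpotential_le _ _ (disc01 k)).
    + exact: (dpotential_le _ _ (disc01 k)).
    + rewrite lee_fin /G lerD2l; exact: ler_wpM2r.
have c1 : (f x - beta k)%:E + (discount k)%:E * \int[P x]_y (g k y)%:E @[k --> \oo]
    --> (f x - pif)%:E + 1 * \int[P x]_y poisson_sol y.
  apply: cvgeD.
  - by rewrite fin_num_adde_defr.
  - by apply: cvg_EFin; [exact: nearW|apply: cvgB; [exact: cvg_cst|exact: beta_cvg]].
  - apply: cvgeM => //.
    + by apply: mule_def_fin => //; exact: integrable_fin_num.
    + by apply: cvg_EFin; [exact: nearW|exact: discount_cvg].
have solE : poisson_sol x = (f x - pif)%:E + 1 * \int[P x]_y poisson_sol y.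
  have := g_cvg x; rewrite (_ : (fun k => _) = fun k =>
    (f x - beta k)%:E + (discount k)%:E * \int[P x]_y (g k y)%:E); last first.
    by apply/funext => k; exact: g_rec.
  by move=> c0; exact: (cvg_unique _ c0 c1).
have Ps : \int[P x]_y poisson_sol y \is a fin_num by exact: integrable_fin_num.
rewrite solE mul1e -(fineK integral_pi_fin) -/pif.
move: (\int[P x]_y poisson_sol y) Ps => [a| |]// _.
by congr EFin; ring.
Qed.

End poisson.

End killed_chain.

(** * The split chain *)

Section split_chain_law.
Context {R : realType} {d dO : measure_display}.
Context {S : measurableType d} {Omega : measurableType dO}.
Variables (P : R.-pker S ~> S) (Pr : R.-pker S ~> Omega).
Variables (X : nat -> {mfun Omega >-> S}) (B : nat -> {mfun Omega >-> bool}).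
Variables (C : set S) (m : nat) (lambda : R) (phi : probability S R).
Variables (Q : R.-pker S ~> S) (K : R.-pker (S * S)%type ~> (m.-1.-tuple S)).
Hypothesis hX : markov_chain P Pr X.
Hypothesis mC : measurable C.
Hypothesis m1 : (1 <= m)%N.
Hypothesis lambda01 : (0 < lambda <= 1)%R.
Hypothesis hQ : residual_kernel Pr X C m lambda phi Q.
Hypothesis hK : bridge_kernel Pr X C K.
Hypothesis hsplit : split_construction P Pr X B C lambda phi Q K.

Notation att := (attempt_at X C m).
Notation fre := (free_at X C m).
Notation hist := (history X B C m).

Definition success_at (n : nat) : set Omega := att n `&` B n @^-1` [set true].

Definition untried_at (n : nat) : set Omega :=
  [set w | no_success C m (X ^~ w) (B ^~ w) n].

Definition alive_at (n : nat) : set Omega :=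
  [set w | alive C m (X ^~ w) (B ^~ w) n].

(** The sequence of attempts goes on after a success; [try_at] retains those up to and including the
    first success, that is, the times [T_1, ..., T_beta]. *)
Definition try_at (n : nat) : set Omega := att n `&` untried_at n.

(** * Measurability of the events of the construction *)

Lemma measurable_forall (D : set nat) (F : nat -> set Omega) :
  (forall t, D t -> measurable (F t)) -> measurable [set w | forall t, D t -> F t w].
Proof. exact: bigcap_measurableType. Qed.

Lemma measurable_attempt_at n : measurable (att n).
Proof.
elim/ltn_ind: n => n ih.
rewrite (_ : att n = X n @^-1` C `&`
    [set w | forall t, [set t | (t < n)%N /\ (n < t + m)%N] t -> (~` att t) w]).
  apply: measurableI; first exact: measurable_funPTI.
  by apply: measurable_forall => t [tn _]; apply: measurableC; exact: ih.
apply/seteqP; split=> w; rewrite /attempt_at /= (is_attemptE C m m1) => -[Cn nat_];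
  split=> //.
  by move=> t [tn ntm]; exact: nat_.
by move=> t tn ntm; exact: nat_.
Qed.

Lemma measurable_free_at n : measurable (fre n).
Proof.
rewrite (_ : fre n = [set w | forall t, [set t | (t <= n < t + m)%N] t ->
  (~` att t) w]).
  by apply: measurable_forall => t _; apply: measurableC; exact: measurable_attempt_at.
apply/seteqP; split=> w /= wn.
  by move=> t tn [i it]; exact: (wn i t).
by move=> i t it tn; apply: (wn t tn); exists i.
Qed.

Lemma measurable_success_at n : measurable (success_at n).
Proof.
apply: measurableI; first exact: measurable_attempt_at.
exact: measurable_funPTI.
Qed.

Lemma measurable_untried_at n : measurable (untried_at n).
Proof.
rewrite (_ : untried_at n =
    [set w | forall t, [set t | (t < n)%N] t -> (~` success_at t) w]).
  by apply: measurable_forall => t _; apply: measurableC; exact: measurable_success_at.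
apply/seteqP; split=> w wn t tn.
  by move=> [at_ /= bt]; have := wn t tn at_; rewrite bt.
by move=> at_; apply/negP => bt; apply: (wn t tn).
Qed.

Lemma measurable_alive_at n : measurable (alive_at n).
Proof.
rewrite (_ : alive_at n =
    [set w | forall t, [set t | (t + m <= n)%N] t -> (~` success_at t) w]).
  by apply: measurable_forall => t _; apply: measurableC; exact: measurable_success_at.
apply/seteqP; split=> w wn t.
  by move=> /= tmn [at_ bt]; have := wn t at_ bt; lia.
by move=> at_ bt; rewrite ltnNge; apply/negP => tmn; exact: (wn t tmn).
Qed.

Lemma measurable_try_at n : measurable (try_at n).
Proof.
by apply: measurableI; [exact: measurable_attempt_at|exact: measurable_untried_at].
Qed.

(* Coins are masked off the attempt times, so a history whose coins are all
   [false] is one in which every attempt has failed. *)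
Definition failed_history n (A : set S) : set (n.+1.-tuple S * n.-tuple bool) :=
  [set h | A (tnth h.1 ord_max) /\ forall i, tnth h.2 i = false].

Lemma measurable_failed_history n A : measurable A -> measurable (failed_history n A).
Proof.
move=> mA.
have m1' : measurable_fun setT
    (fun h : n.+1.-tuple S * n.-tuple bool => tnth h.1 ord_max).
  exact: (measurableT_comp (measurable_tnth ord_max) measurable_fst).
have m2 i : measurable_fun setT
    (fun h : n.+1.-tuple S * n.-tuple bool => tnth h.2 i).
  exact: (measurableT_comp (measurable_tnth i) measurable_snd).
rewrite (_ : failed_history n A = (fun h => tnth h.1 ord_max) @^-1` A `&`
    \bigcap_(i in [set: 'I_n]) (fun h => tnth h.2 i) @^-1` [set false]).
  apply: measurableI; first by rewrite -[X in measurable X]setTI; exact: m1'.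
  apply: fin_bigcap_measurable => // i _.
  by rewrite -[X in measurable X]setTI; exact: m2.
by apply/seteqP; split=> h [hA hi]; split=> // i; [move=> _; exact: hi|exact: hi].
Qed.

(** Places [untried_at n] in the sigma-algebra of [hist n], so that the conditional laws of
    [split_construction] may be used on it. *)
Lemma failed_historyE n A : hist n @^-1` failed_history n A =
  untried_at n `&` X n @^-1` A.
Proof.
apply/seteqP; split=> w /=.
  rewrite /failed_history /history /= tnth_mktuple => -[wA wi]; split=> // t tn at_.
  have := wi (Ordinal tn); rewrite tnth_mktuple /=.
  by move/negbT; rewrite negb_and; case/orP => //; rewrite asboolT.
rewrite /failed_history /history /= tnth_mktuple => -[un wA]; split=> // i.
rewrite tnth_mktuple; apply/negbTE; rewrite negb_and.
case: (pselect (att i w)) => at_; last by rewrite asboolF.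
by rewrite (un i (ltn_ord i) at_) orbT.
Qed.

Lemma try_atE n A : att n `&` hist n @^-1` failed_history n A =
  try_at n `&` X n @^-1` A.
Proof. by rewrite failed_historyE setIA. Qed.

(** * Multi-step laws of the chain and laws along a block *)

Let L k : R.-spker S ~> S := klaw Pr setT measurableT (X k).

Let LE k x A : L k x A = Pr x (X k @^-1` A).
Proof. by rewrite /L klawE setTI. Qed.

Lemma law0 x A : measurable A -> Pr x (X 0%N @^-1` A) = \d_x A.
Proof. by move=> mA; have [+ _] := hX x; exact. Qed.

Lemma lawS k x A : measurable A ->
  L k.+1 x A = \int[L k x]_y P y A.
Proof.
move=> mA; rewrite LE integral_klaw//; last exact: measurable_kernel.
have [_ /(_ k setT A measurableT mA)] := hX x.
by rewrite preimage_setT !setTI.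
Qed.

Lemma coin_law x n A b : measurable A ->
  Pr x (try_at n `&` X n @^-1` A `&` B n @^-1` [set b]) =
  bernoulli_prob lambda [set b] * Pr x (try_at n `&` X n @^-1` A).
Proof.
move=> mA; have [_ h _ _] := hsplit x n.
have mb : measurable [set b] by [].
have := h (failed_history n A) [set b] (measurable_failed_history n A mA) mb.
rewrite try_atE => ->; rewrite integral_cst//.
by apply: measurableI; [exact: measurable_try_at|exact: measurable_funPTI].
Qed.

Lemma bernoulli_true : bernoulli_prob lambda [set true] = lambda%:E.
Proof.
case/andP: lambda01 => l0 l1.
by rewrite /bernoulli_prob (ltW l0) l1/= fsbig_set1.
Qed.

Lemma bernoulli_false : bernoulli_prob lambda [set false] = (1 - lambda)%:E.
Proof.
case/andP: lambda01 => l0 l1.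
by rewrite /bernoulli_prob (ltW l0) l1/= fsbig_set1.
Qed.

Lemma measurable_try_coin n b : measurable (try_at n `&` B n @^-1` [set b]).
Proof. by apply: measurableI; [exact: measurable_try_at|exact: measurable_funPTI]. Qed.

Definition failed_coin n (A : set S) (b : bool) :
    set ((n.+1.-tuple S * n.-tuple bool) * bool) :=
  [set hb | failed_history n A hb.1 /\ hb.2 = b].

Lemma measurable_failed_coin n A b : measurable A -> measurable (failed_coin n A b).
Proof.
move=> mA.
rewrite (_ : failed_coin n A b = fst @^-1` failed_history n A `&` snd @^-1` [set b])//.
apply: measurableI; rewrite -[X in measurable X]setTI.
  by apply: measurable_fst => //; exact: measurable_failed_history.
exact: measurable_snd.
Qed.

Lemma try_coinE n A b :
  att n `&` (fun w => (hist n w, B n w)) @^-1` failed_coin n A b =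
  try_at n `&` X n @^-1` A `&` B n @^-1` [set b].
Proof. by rewrite -try_atE -setIA. Qed.

(** The coin is independent of the past, so restricting to one of its values scales the law of [X n]
    on the attempt by the weight of that value. *)
Lemma coin_integral x n A b (a : R) (h : S -> \bar R) : (0 <= a)%R ->
  bernoulli_prob lambda [set b] = a%:E -> measurable A ->
  measurable_fun setT h -> (forall y, 0 <= h y) ->
  \int[Pr x]_(w in try_at n `&` X n @^-1` A `&` B n @^-1` [set b]) h (X n w) =
  a%:E * \int[Pr x]_(w in try_at n `&` X n @^-1` A) h (X n w).
Proof.
move=> a0 ba mA mh h0.
have mE : measurable (try_at n `&` X n @^-1` A).
  by apply: measurableI; [exact: measurable_try_at|exact: measurable_funPTI].
have mEb : measurable (try_at n `&` X n @^-1` A `&` B n @^-1` [set b]).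
  by apply: measurableI => //; exact: measurable_funPTI.
rewrite -(integral_klaw Pr _ mEb (X n) x h mh h0).
rewrite -(integral_klaw Pr _ mE (X n) x h mh h0).
rewrite -(ge0_integral_mscale _ measurableT (NngNum a0) mh (fun y _ => h0 y)).
apply: eq_measure_integral => A' mA' _.
rewrite [RHS]/= /mscale/= !klawE.
have := coin_law x n (A `&` A') b (measurableI _ _ mA mA').
by rewrite ba preimage_setI !setIA => <-; congr (Pr x _); rewrite setIAC.
Qed.

(** Source of the term [p_n phi]: after a success the end of the block is a fresh draw from
    [phi]. *)
Lemma success_law x n A : measurable A ->
  Pr x (try_at n `&` B n @^-1` [set true] `&` X (n + m)%N @^-1` A) =
  lambda%:E * Pr x (try_at n) * phi A.
Proof.
move=> mA; have [_ _ h _] := hsplit x n.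
have := h _ A (measurable_failed_coin n setT true measurableT) mA.
rewrite try_coinE preimage_setT setIT => ->.
transitivity (\int[Pr x]_(w in try_at n `&` B n @^-1` [set true]) phi A).
  by apply: eq_integral => w; rewrite inE /= => -[_ ->].
rewrite integral_cst//; last exact: measurable_try_coin.
rewrite muleC; congr (_ * _).
have := coin_law x n setT true measurableT.
by rewrite preimage_setT setIT bernoulli_true.
Qed.

(** Summing over the two values of the coin gives the mixture [lambda * phi + (1 - lambda) * Q],
    which by [hQ] is the law of [X_m], the state at an attempt time being in [C]. *)
Lemma block_end_law x n A A' : measurable A -> measurable A' ->
  Pr x (try_at n `&` X n @^-1` A `&` X (n + m)%N @^-1` A') =
  \int[Pr x]_(w in try_at n `&` X n @^-1` A) L m (X n w) A'.
Proof.
move=> mA mA'; have [_ _ h _] := hsplit x n.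
have mE : measurable (try_at n `&` X n @^-1` A).
  by apply: measurableI; [exact: measurable_try_at|exact: measurable_funPTI].
have mEb b : measurable (try_at n `&` X n @^-1` A `&` B n @^-1` [set b]).
  by apply: measurableI => //; exact: measurable_funPTI.
have hb b : Pr x (try_at n `&` X n @^-1` A `&` B n @^-1` [set b] `&` X (n + m)%N @^-1` A') =
    \int[Pr x]_(w in try_at n `&` X n @^-1` A `&` B n @^-1` [set b])
       (if b then phi A' else Q (X n w) A').
  have := h _ A' (measurable_failed_coin n A b mA) mA'.
  by rewrite try_coinE => ->; apply: eq_integral => w; rewrite inE /= => -[_ ->].
have mQ : measurable_fun setT (fun y => Q y A') by exact: measurable_kernel.
have [l0 l1] : (0 <= lambda)%R /\ (0 <= 1 - lambda)%R.
  by case/andP: lambda01 => l0 l1; rewrite subr_ge0 ltW.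
transitivity (lambda%:E * \int[Pr x]_(w in try_at n `&` X n @^-1` A) phi A' +
    (1 - lambda)%:E * \int[Pr x]_(w in try_at n `&` X n @^-1` A) Q (X n w) A').
  rewrite -(coin_integral x n A true _ (fun=> phi A') l0 bernoulli_true)//.
  rewrite -(coin_integral x n A false _ (fun y => Q y A') l1 bernoulli_false)//.
  rewrite -(hb true) -(hb false) -measureU; last 3 first.
  - by apply: measurableI => //; exact: measurable_funPTI.
  - by apply: measurableI => //; exact: measurable_funPTI.
  - by apply/seteqP; split=> w //= [[[_ ->] _] [[_ ]]].
  congr (Pr x _); apply/seteqP; split=> w /=; last by tauto.
  by move=> [wA wA']; case: (B n w); [left|right].
have mQX : measurable_fun setT (fun w => Q (X n w) A').
  by apply: (measurableT_comp mQ).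
rewrite -!ge0_integralZl_EFin//; last exact: measurable_funTS.
rewrite -ge0_integralD//; last 3 first.
- by move=> w _; rewrite mule_ge0.
- by move=> w _; rewrite mule_ge0.
- by apply: measurable_funTS; exact: measurable_funeM.
apply: eq_integral => w; rewrite inE => -[[[i /attempt_C Cw] _] _].
by rewrite LE hQ.
Qed.

(* The coin and the residual kernel average out: from an attempt time on, the
   block is a path of the chain, at least as far as its marginals go. *)
Lemma block_law x n k A A' : (k <= m)%N -> measurable A -> measurable A' ->
  Pr x (try_at n `&` X n @^-1` A `&` X (n + k)%N @^-1` A') =
  \int[Pr x]_(w in try_at n `&` X n @^-1` A) L k (X n w) A'.
Proof.
rewrite leq_eqVlt => /orP[/eqP ->|km] mA mA'; first exact: block_end_law.
have mE : measurable (try_at n `&` X n @^-1` A).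
  by apply: measurableI; [exact: measurable_try_at|exact: measurable_funPTI].
case: k km => [|k] km.
  have mX : measurable (X n @^-1` A') by exact: measurable_funPTI.
  rewrite addn0 setIC -(integral_indic _ mE mX).
  by apply: eq_integral => w _; rewrite LE law0// diracE indicE.
(* [intermediate] starts with [X (n + 1)], so [X (n + k.+1)] is its component of index [k]. *)
have km' : (k < m.-1)%N by lia.
pose T : set (m.-1.-tuple S) := (fun s => tnth s (Ordinal km')) @^-1` A'.
have mT : measurable T.
  by rewrite /T -[X in measurable X]setTI; exact: measurable_tnth.
have [_ _ _ h] := hsplit x n.
have mF : measurable [set hby : ((n.+1.-tuple S * n.-tuple bool) * bool) * S |
    failed_history n A hby.1.1].
  rewrite (_ : [set hby | _] = (fun u => u.1.1) @^-1` failed_history n A)//.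
  rewrite -[X in measurable X]setTI.
  by apply: (measurableT_comp measurable_fst measurable_fst) => //;
    exact: measurable_failed_history.
have := h _ T mF mT.
rewrite (_ : att n `&` _ @^-1` [set hby | _] = try_at n `&` X n @^-1` A); last first.
  by rewrite -try_atE.
rewrite (_ : intermediate X m n @^-1` T = X (n + k.+1)%N @^-1` A'); last first.
  by apply/seteqP; split=> w; rewrite /T /= tnth_mktuple.
move=> ->.
have mKT : measurable_fun setT (fun u : S * S => K u T) by exact: measurable_kernel.
(* The bridge law depends on both ends of the block, whose joint law is [block_end_law]. Integrating
   the far end over [L m] gives back, by [hK], the law of [X k.+1] started from [X n]. *)
rewrite (disintegration (Pr x) (sprob_kernel_le1 Pr x) _ mE (X n) (X (n + m)%N) (L m) _
  (fun u => K u T) (fun u => measure_ge0 _ _) mKT); last first.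
  move=> A1 A2 mA1 mA2.
  have := block_end_law x n (A `&` A1) A2 (measurableI _ _ mA mA1) mA2.
  by rewrite preimage_setI !setIA.
apply: eq_integral => w; rewrite inE => -[[[i /attempt_C Cw] _] _].
have := hK _ Cw setT T measurableT mT.
rewrite preimage_setT !setTI (_ : intermediate X m 0 @^-1` T = X k.+1 @^-1` A');
  last first.
  by apply/seteqP; split=> w'; rewrite /T /= tnth_mktuple.
rewrite LE => ->; rewrite integral_klaw//.
exact: (measurableT_comp mKT (pair1_measurable _)).
Qed.

(** Compares [block_law] at [k.+1] and at [k] through one step of the unsplit chain. The coin of the
    block must stay averaged out: given its value, the steps inside the block need not follow
    [P]. *)
Lemma block_step x n k A : (k < m)%N -> measurable A ->
  Pr x (try_at n `&` X (n + k).+1 @^-1` A) =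
  \int[Pr x]_(w in try_at n) P (X (n + k)%N w) A.
Proof.
move=> km mA.
have := block_law x n k.+1 setT A km measurableT mA.
rewrite preimage_setT setIT addnS => ->.
have mPA : measurable_fun setT (fun u : S * S => P u.2 A).
  exact: (measurableT_comp (measurable_kernel P _ mA) measurable_snd).
rewrite (disintegration (Pr x) (sprob_kernel_le1 Pr x) _ (measurable_try_at n)
  (X n) (X (n + k)%N) (L k) _
  (fun u => P u.2 A) (fun u => measure_ge0 _ _) mPA); last first.
  by move=> A1 A2 mA1 mA2; exact: block_law (ltnW km) mA1 mA2.
by apply: eq_integral => w _; rewrite lawS.
Qed.

(** * One step of the chain before regeneration *)

Lemma free_step x n A : measurable A ->
  Pr x (fre n `&` untried_at n `&` X n.+1 @^-1` A) =
  \int[Pr x]_(w in fre n `&` untried_at n) P (X n w) A.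
Proof.
move=> mA; have [h _ _ _] := hsplit x n.
have := h _ A (measurable_failed_history n setT measurableT) mA.
by rewrite failed_historyE preimage_setT setIT.
Qed.

(* The pieces of [alive_at n]: at i = 0 the chain is free at time n, otherwise
   time n lies in the block of the attempt made at time i - 1. *)
Definition alive_piece n i : set Omega :=
  if i is t.+1 then
    if (t <= n < t + m)%N then try_at t else set0
  else fre n `&` untried_at n.

Lemma measurable_alive_piece n i : measurable (alive_piece n i).
Proof.
case: i => [|t] /=.
  by apply: measurableI; [exact: measurable_free_at|exact: measurable_untried_at].
by case: ifP => // _; exact: measurable_try_at.
Qed.

Lemma alive_pieces n : alive_at n = \bigcup_i alive_piece n i.
Proof.
apply/seteqP; split=> w.
  move=> /(aliveP C m m1)[[fw uw]|[t [tn ntm aw uw]]]; first by exists 0%N.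
  by exists t.+1 => //=; rewrite tn ntm.
move=> [[|t] _] /=; first by move=> [fw uw]; apply/(aliveP C m m1); left.
case: ifP => // /andP[tn ntm] [aw uw].
by apply/(aliveP C m m1); right; exists t.
Qed.

Lemma trivIset_alive_piece n : trivIset setT (alive_piece n).
Proof.
apply/trivIsetP => i j _ _; wlog : i j / (i < j)%N => [h ij|ij _].
  move: (ij); rewrite neq_ltn => /orP[|ji]; first by move=> /h; exact.
  by rewrite setIC; apply: h => //; rewrite eq_sym.
case: j ij => // s; rewrite ltnS => is_ /=; case: ifP => [/andP[sn nsm]|_];
  last by rewrite setI0.
apply/seteqP; split=> w //; case: i is_ => [_|t ts] /=.
  by move=> [[fw _] [[k ks] _]]; apply: (fw k s ks); rewrite sn nsm.
case: ifP => [/andP[tn ntm]|_]; last by case.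
move=> [[at_ _] [as_ _]].
by have := is_attempt_gap C m m1 _ _ _ at_ as_ ts; lia.
Qed.

(** Sums [free_step] and [block_step] over the disjoint pieces. The event concerns survival at [n],
    not at [n.+1], so the last step of a successful block is included. *)
Lemma alive_step x n A : measurable A ->
  Pr x (alive_at n `&` X n.+1 @^-1` A) =
  \int[Pr x]_(w in alive_at n) P (X n w) A.
Proof.
move=> mA; rewrite alive_pieces ge0_integral_bigcup//; last 3 first.
- exact: measurable_alive_piece.
- apply: measurable_funTS.
  by apply: (measurableT_comp (measurable_kernel P _ mA)).
- exact: trivIset_alive_piece.
have mXA : measurable (X n.+1 @^-1` A) by exact: measurable_funPTI.
have mF i : measurable (alive_piece n i `&` X n.+1 @^-1` A).
  by apply: measurableI => //; exact: measurable_alive_piece.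
rewrite setI_bigcupl measure_semi_bigcup//; last 2 first.
- by apply: trivIset_setIr; exact: trivIset_alive_piece.
- exact: bigcup_measurable.
apply: eq_eseriesr => -[|t] _ /=; first exact: free_step.
case: ifP => [/andP[tn ntm]|_]; last by rewrite set0I measure0 integral_set0.
by have := block_step x t (n - t)%N A; rewrite subnKC//; apply=> //; lia.
Qed.

Lemma alive_succeed n : alive_at n `\` alive_at n.+1 =
  if (m <= n.+1)%N then try_at (n.+1 - m) `&` B (n.+1 - m)%N @^-1` [set true] else set0.
Proof.
apply/seteqP; split=> w.
  move=> [al nal]; have := nal; rewrite /alive_at /= (aliveS C m m1 _ _ _ al).
  move=> /contrapT[t [nE at_ ut bt]]; rewrite nE leq_addl addnK.
  by split.
case: ifP => // mn [[at_ ut] bt]; split.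
  by apply/(aliveP C m m1); right; exists (n.+1 - m)%N; split=> //; lia.
move=> al'; have al := alive_pred C m m1 _ _ _ al'.
have := (aliveS C m m1 _ _ _ al).1 al'; apply; exists (n.+1 - m)%N; split=> //.
by rewrite subnK.
Qed.

(** * The killed chain of the construction *)

Definition killed_kernel n : R.-spker S ~> S :=
  klaw Pr (alive_at n) (measurable_alive_at n) (X n).

Definition kill_prob n x := Pr x (alive_at n `\` alive_at n.+1).

Lemma killed_kernel0 x A : measurable A -> killed_kernel 0 x A = \d_x A.
Proof.
move=> mA; rewrite klawE (_ : alive_at 0 = setT) ?setTI ?law0//.
by apply/seteqP; split=> // w _ t _ _; lia.
Qed.

(** A path alive at [n] either survives the next step or completes a successful block; in the latter
    case [alive_succeed] and [success_law] show that the new state has law [phi], independently of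
    that event. *)
Lemma killed_kernel_step n x A : measurable A ->
  \int[killed_kernel n x]_y P y A = killed_kernel n.+1 x A + kill_prob n x * phi A.
Proof.
move=> mA; rewrite integral_klaw//; last exact: measurable_kernel.
rewrite -alive_step// klawE.
have mXA : measurable (X n.+1 @^-1` A) by exact: measurable_funPTI.
have mD : measurable (alive_at n `\` alive_at n.+1).
  by apply: measurableD; exact: measurable_alive_at.
transitivity (Pr x (alive_at n.+1 `&` X n.+1 @^-1` A) +
    Pr x ((alive_at n `\` alive_at n.+1) `&` X n.+1 @^-1` A)).
  rewrite -measureU; last 3 first.
  - by apply: measurableI => //; exact: measurable_alive_at.
  - exact: measurableI.
  - by apply/seteqP; split=> w //= [[al _] [[_ nal] _]].
  congr (Pr x _); apply/seteqP; split=> w /=.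
    by move=> [al wA]; have [al'|nal] := pselect (alive_at n.+1 w); [left|right].
  by move=> [[/(alive_pred C m m1) al wA]|[[al _] wA]].
congr (_ + _); rewrite /kill_prob alive_succeed.
case: ifP => mn; last by rewrite set0I measure0 mul0e.
have := success_law x (n.+1 - m) A mA; rewrite subnK// => ->; congr (_ * _).
have := coin_law x (n.+1 - m) setT true measurableT.
by rewrite preimage_setT setIT bernoulli_true => ->.
Qed.

(** * Expected number of attempts and of visits to [C] *)

Lemma sum_block (e : \bar R) t N : 0 <= e ->
  \sum_(0 <= n < N) (if (t <= n < t + m)%N then e else 0) =
  (minn N (t + m) - t)%:R%:E * e.
Proof.
move=> e0; elim: N => [|N ih].
  by rewrite big_geq// (_ : (_ - _)%N = 0%N) ?mul0e//; lia.
rewrite big_nat_recr//= ih; case: ifPn => tN.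
  rewrite (_ : (minn N.+1 (t + m) - t)%N = (minn N (t + m) - t).+1); last by lia.
  by rewrite -[X in _ + X]mul1e -ge0_muleDl ?lee_fin// -EFinD natr1.
by rewrite adde0; congr (_%:R%:E * _); lia.
Qed.

(** The events of a first success at [t] are disjoint in [t] and have probability [lambda] times
    that of [try_at t], so these products sum to at most 1. *)
Lemma sum_try x : \sum_(t <oo) Pr x (try_at t) <= (lambda^-1)%:E.
Proof.
have /andP[l0 l1] := lambda01.
have mF t : measurable (try_at t `&` B t @^-1` [set true]) by exact: measurable_try_coin.
have E t : lambda%:E * Pr x (try_at t) = Pr x (try_at t `&` B t @^-1` [set true]).
  have := coin_law x t setT true measurableT.
  by rewrite preimage_setT setIT bernoulli_true.
rewrite -(@lee_pmul2l _ lambda%:E)// -EFinM divff ?gt_eqF// -nneseriesZl//.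
rewrite (eq_eseriesr (fun t _ => E t)) -measure_semi_bigcup//; last 2 first.
- apply/trivIsetP => i j _ _; wlog : i j / (i < j)%N => [h ij|ij _].
    move: (ij); rewrite neq_ltn => /orP[|ji]; first by move=> /h; exact.
    by rewrite setIC; apply: h => //; rewrite eq_sym.
  apply/seteqP; split=> w // [[[ai _] bi] [[_ uj] _]].
  by have := uj i ij ai; rewrite (bi : B i w = true).
- exact: bigcup_measurable.
apply: le_trans (sprob_kernel_le1 Pr x); apply: le_measure; rewrite ?inE//.
exact: bigcup_measurable.
Qed.

(** Each visit to [C] before [tau] lies in the block of some try, and a block contains at most [m]
    times; [sum_try] bounds the number of tries. *)
Lemma killed_kernel_C x : \sum_(n <oo) killed_kernel n x C <= (m%:R / lambda)%:E.
Proof.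
pose e t := Pr x (try_at t).
have le_e n : killed_kernel n x C <=
    \sum_(t <oo) (if (t <= n < t + m)%N then e t else 0).
  have mXC : measurable (X n @^-1` C) by exact: measurable_funPTI.
  have mF i : measurable (alive_piece n i `&` X n @^-1` C).
    by apply: measurableI => //; exact: measurable_alive_piece.
  rewrite klawE alive_pieces setI_bigcupl measure_semi_bigcup//; last 2 first.
  - by apply: trivIset_setIr; exact: trivIset_alive_piece.
  - exact: bigcup_measurable.
  rewrite nneseriesS// (_ : alive_piece n 0 `&` _ = set0); last first.
    (* A visit to [C] at a free time would be an attempt by [is_attemptE], so the free piece
       contributes nothing. *)
    apply/seteqP; split=> w // [[fw _] Cw].
    have nat_ t : (t < n)%N -> (n < t + m)%N -> ~ att t w.
      by move=> tn ntm [i it]; apply: (fw i t it); rewrite ltnW.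
    have [i ni] := (is_attemptE C m m1 (X ^~ w) n).2 (conj Cw nat_).
    by apply: (fw i n ni); rewrite leqnn; lia.
  rewrite measure0 add0e; apply: lee_nneseries => [t _ _|t _]; first exact: measure_ge0.
  rewrite /=; case: ifP => _; last by rewrite set0I measure0.
  apply: le_measure; rewrite ?inE; last exact: subIsetl.
  - by apply: measurableI => //; exact: measurable_try_at.
  - exact: measurable_try_at.
have f0 t n : 0 <= (if (t <= n < t + m)%N then e t else 0) by case: ifP.
apply: lime_le; first exact: is_cvg_nneseries.
apply: nearW => N.
apply: (@le_trans _ _ (\sum_(0 <= n < N)
  \sum_(t <oo) (if (t <= n < t + m)%N then e t else 0))).
  by apply: lee_sum => n _; exact: le_e.
rewrite -nneseries_sum_nat//.
apply: (@le_trans _ _ (\sum_(t <oo) m%:R%:E * e t)).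
  apply: lee_nneseries => [t _ _|t _]; first exact: sume_ge0.
  rewrite sum_block// lee_wpmul2r// lee_fin ler_nat; lia.
rewrite nneseriesZl// EFinM; apply: lee_wpmul2l; first by rewrite lee_fin.
exact: sum_try.
Qed.

(** * Identification of [gstar] with a difference of potentials *)

Lemma potential_killedE (h : S -> \bar R) x :
  measurable_fun setT h -> (forall y, 0 <= h y) ->
  potential killed_kernel h x =
  \int[Pr x]_w \sum_(n <oo) ((h \o X n) \_ (alive_at n)) w.
Proof.
move=> mh h0; rewrite integral_nneseries//; last 2 first.
- move=> n; apply/(measurable_restrictT _ (measurable_alive_at n)).
  by apply: measurable_funTS; exact: measurableT_comp.
- by move=> n w _; rewrite patchE; case: ifP => // _; exact: h0.
apply: eq_eseriesr => n _.
by rewrite -integral_mkcond integral_klaw.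
Qed.

Lemma sum_tau (h : S -> \bar R) w t : (forall y, 0 <= h y) ->
  tau C m (X ^~ w) (B ^~ w) = Some t ->
  \sum_(n <oo) ((h \o X n) \_ (alive_at n)) w = \sum_(0 <= j < t) h (X j w).
Proof.
move=> h0 wt; have := tauP C m m1 (X ^~ w) (B ^~ w); rewrite wt => al.
rewrite (nneseries_split 0 t); last by move=> n _; rewrite patchE;
  case: ifP => // _; exact: h0.
rewrite [X in _ + X]eseries0 ?adde0 ?add0n.
  apply: eq_big_nat => j /andP[_ jt]; rewrite patchE mem_set//=.
  exact/al.
move=> n /= tn _; rewrite patchE memNset//= => /al.
by rewrite ltnNge -[t]add0n tn.
Qed.

Lemma sum_tau_None w : tau C m (X ^~ w) (B ^~ w) = None ->
  \sum_(n <oo) ((cst 1 \o X n) \_ (alive_at n)) w = +oo :> \bar R.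
Proof.
move=> wN; have := tauP C m m1 (X ^~ w) (B ^~ w); rewrite wN => al.
rewrite (eq_eseriesr (g := fun=> 1)); last first.
  by move=> n _; rewrite patchE mem_set//; exact: al.
apply/eqyP => a a0.
apply: (@le_trans _ _ (\sum_(0 <= n < (Num.truncn a).+1) 1)); last first.
  by apply: nneseries_lim_ge => n _ _; rewrite lee_fin.
rewrite (eq_bigr (fun=> 1%R%:E))// sumEFin sumr_const_nat subn0 lee_fin.
exact: ltW (Num.Theory.truncnS_gt _).
Qed.

(** [F] and [T] are the sum of [f] before [tau] and [tau] itself, both integrable by the finiteness
    of the potentials. The integrand of [gstar] is [F - a T] wherever [tau] is finite. *)
Lemma gstarE (f : S -> R) (a : R) x :
  measurable_fun setT f -> (forall y, 0 <= f y)%R ->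
  potential killed_kernel (EFin \o f) x < +oo ->
    potential killed_kernel (cst 1) x < +oo ->
  gstar Pr X B C m (fun y => (f y)%:E - a%:E) x =
  potential killed_kernel (EFin \o f) x - a%:E * potential killed_kernel (cst 1) x.
Proof.
move=> mf f0.
have mfE : measurable_fun setT (EFin \o f) by exact/measurable_EFinP.
have fE0 y : 0 <= (EFin \o f) y by rewrite lee_fin.
have c10 (y : S) : 0 <= (cst 1 y : \bar R) by rewrite lee_fin.
rewrite !potential_killedE//.
set F := fun w => \sum_(n <oo) ((EFin \o f \o X n) \_ (alive_at n)) w.
set T := fun w => \sum_(n <oo) ((cst 1 \o X n) \_ (alive_at n)) w.
have F0 w : 0 <= F w.
  by apply: nneseries_ge0 => n _ _; rewrite patchE; case: ifP => // _; exact: fE0.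
have T0 w : 0 <= T w.
  by apply: nneseries_ge0 => n _ _; rewrite patchE; case: ifP.
have mser (h : S -> \bar R) : measurable_fun setT h -> (forall y, 0 <= h y) ->
    measurable_fun setT (fun w => \sum_(n <oo) ((h \o X n) \_ (alive_at n)) w).
  move=> mh h0; apply: ge0_emeasurable_sum => [n w _ _|n _].
    by rewrite patchE; case: ifP => // _; exact: h0.
  apply/(measurable_restrictT _ (measurable_alive_at n)).
  by apply: measurable_funTS; exact: measurableT_comp.
have mF : measurable_fun setT F by exact: mser.
have mT : measurable_fun setT T by exact: mser.
move=> Ffin Tfin.
(* Exactly the event that [tau] is finite: off it [sum_tau_None] gives [T = +oo]. Integrability of
   [T] makes its complement negligible, and there [gstar] integrates 0. *)
pose D := [set w | T w < +oo].
have mD : measurable D.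
  rewrite /D -[X in measurable X]setTI; exact: emeasurable_fun_infty_o.
have iT : (Pr x).-integrable setT T.
  by apply/integrableP; split=> //; under eq_integral do rewrite gee0_abs//.
have iF : (Pr x).-integrable setT F.
  by apply/integrableP; split=> //; under eq_integral do rewrite gee0_abs//.
have PD : Pr x (~` D) = 0.
  apply: measure_negligible; first exact: measurableC.
  apply: negligibleS (integrable_ae measurableT iT) => w /= nD h.
  by apply: nD; rewrite /D /= -ge0_fin_numE//; exact: h.
transitivity (\int[Pr x]_(w in D) (F w - a%:E * T w)).
  rewrite integral_mkcond; apply: eq_integral => w _; rewrite patchE.
  case E: (tau C m (X ^~ w) (B ^~ w)) => [t|]; last first.
    by rewrite memNset// /D /= /T sum_tau_None.
  have TE : T w = t%:R%:E.
    rewrite /T (sum_tau _ _ _ c10 E) (eq_bigr (fun=> 1%R%:E))// sumEFin.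
    by rewrite sumr_const_nat subn0.
  rewrite mem_set; last by rewrite /D /= TE ltry.
  rewrite TE /F (sum_tau _ _ _ fE0 E) /= (eq_bigr (fun j => (f (X j w) - a)%:E))//.
  rewrite !sumEFin; congr EFin.
  by rewrite sumrB sumr_const_nat subn0 mulr_natr.
have iFD : (Pr x).-integrable D F by exact: integrableS iF.
have iTD : (Pr x).-integrable D T by exact: integrableS iT.
rewrite integralB//; last exact: integrableZl.
rewrite integralZl//.
have toT h : measurable_fun setT h -> (forall w, 0 <= h w) ->
    \int[Pr x]_(w in D) h w = \int[Pr x]_w h w.
  move=> mh h0; rewrite [RHS](ge0_negligible_integral (N := ~` D))//; last first.
    exact: measurableC.
  by rewrite setDE setTI setCK.
by rewrite !toT.
Qed.

End split_chain_law.

Theorem theorem2p1 (R : realType) (d dO : measure_display)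
  (S : measurableType d) (Omega : measurableType dO)
  (P : R.-pker S ~> S) (pi : probability S R)
  (Pr : R.-pker S ~> Omega) (X : nat -> {mfun Omega >-> S})
  (hX : markov_chain P Pr X) (hpi : unique_stationary P pi)
  (f : S -> R) (mf : measurable_fun setT f) (f0 : forall x, (0 <= f x)%R)
  (C : set S) (mC : measurable C) (C0 : C !=set0)
  (v1 v2 : S -> R)
  (mv1 : measurable_fun setT v1) (v10 : forall x, (0 <= v1 x)%R)
  (mv2 : measurable_fun setT v2) (v20 : forall x, (0 <= v2 x)%R)
  (phi : probability S R) (m : nat) (m1 : (1 <= m)%N)
  (lambda b1 b2 : R)
  (lambda0 : (0 < lambda)%R) (b10 : (0 < b1)%R) (b20 : (0 < b2)%R)
  (drift1 : forall x,
    \int[P x]_y (v1 y)%:E <= (v1 x - f x + b1 * \1_C x)%:E)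
  (drift2 : forall x,
    \int[P x]_y (v2 y)%:E <= (v2 x - 1 + b2 * \1_C x)%:E)
  (minorization : forall x, C x -> forall A, measurable A ->
    lambda%:E * phi A <= Pr x (X m @^-1` A))
  (B : nat -> {mfun Omega >-> bool})
  (Q : R.-pker S ~> S) (hQ : residual_kernel Pr X C m lambda phi Q)
  (K : R.-pker (S * S)%type ~> (m.-1.-tuple S))
  (hK : bridge_kernel Pr X C K)
  (hsplit : split_construction P Pr X B C lambda phi Q K) :
  let fc := fun x => (f x)%:E - \int[pi]_y (f y)%:E in
  poisson_solution P fc (gstar Pr X B C m fc).
Proof.
(* That [lambda] is at most 1 follows from the minorization of the whole space at some point of the
   nonempty set [C]. *)
move=> fc; have lambda01 : (0 < lambda <= 1)%R.
  have [x Cx] := C0; rewrite lambda0 -lee_fin -[leLHS]mule1.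
  have := minorization x Cx setT measurableT.
  rewrite probability_setT preimage_setT => /le_trans; apply.
  exact: sprob_kernel_le1.
pose M := killed_kernel Pr X B C m lambda mC m1 lambda01.
have p_ge0 n x : 0 <= kill_prob Pr X B C m n x by exact: measure_ge0.
have M_init := killed_kernel0 P Pr X B C m lambda hX mC m1 lambda01.
have M_step := killed_kernel_step P Pr X B C m lambda phi Q K hX mC m1 lambda01
  hQ hK hsplit.
have M_C := killed_kernel_C P Pr X B C m lambda phi Q K mC m1 lambda01 hsplit.
have pif := integral_pi_fin P M _ phi C mC _ p_ge0 M_init M_step M_C
  f v1 v2 b1 b2 pi (ltW b10) (ltW b20) mf mv1 mv2 f0 v10 v20 drift1 drift2 hpi.
have potentialf := potential_f_fin P M _ phi C mC _ p_ge0 M_init M_step M_C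
  f v1 b1 (ltW b10) mf mv1 f0 v10 drift1.
have potential1 := potential_1_fin P M _ phi C mC _ p_ge0 M_init M_step M_C
  v2 b2 (ltW b20) mv2 v20 drift2.
have gE : gstar Pr X B C m fc = poisson_sol M f pi.
  apply/funext => x; rewrite /fc /poisson_sol -(fineK pif).
  exact: (gstarE Pr X B C m lambda
    mC m1 lambda01 f _ x mf f0 (potentialf x) (potential1 x)).
rewrite gE; exact: (killed_chain_poisson P M _ phi C mC _ p_ge0 M_init M_step M_C
  f v1 v2 b1 b2 pi (ltW b10) (ltW b20) mf mv1 mv2 f0 v10 v20 drift1 drift2 hpi).
Qed.
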